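(* Let $d\in\mathbb{N}$ and $\beta>0$. The operator $A_{\beta,d}$ on $L^2(\mu_\beta)$ given by $(A_{\beta,d}f)(s)=\int_{\mathbb{R}^d}K(s,t)f(t)\,d\mu_\beta(t)$ with $$K(s,t)=\exp\Big(-\frac{\|s-t\|^2}2\Big)-\Big\{1+s^\top t+\frac{(s^\top t)^2}2\Big\}\exp\Big(-\frac{\|s\|^2+\|t\|^2}2\Big)$$ is nonnegative, self-adjoint, and trace class. Moreover, $$\operatorname{tr}(A_{\beta,d})=1-(1+2\beta^2)^{-d/2}-d\beta^2(1+2\beta^2)^{-d/2-1}-\frac{d(d+2)}2\beta^4(1+2\beta^2)^{-d/2-2}.$$ It is also injective.
   Context: $\mu_\beta$ is the centered Gaussian probability measure on $\mathbb{R}^d$ with covariance matrix $\beta^2I_d$, and $L^2(\mu_\beta)$ is the real Hilbert space with inner product $\langle f,g\rangle_\beta=\int fg\,d\mu_\beta$. A self-adjoint operator $C$ is called nonnegative if $\langle Cf,f\rangle_\beta\ge0$ for every $f$. *)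

(* Defs.v *)
From HB Require Import structures.
From mathcomp Require Import all_boot all_order all_algebra.
From mathcomp Require Import all_classical all_reals all_analysis.
From mathcomp Require Import measurable_realfun.
From mathcomp Require Import lra.

Set Implicit Arguments.
Unset Strict Implicit.
Unset Printing Implicit Defensive.
Import Order.TTheory GRing.Theory Num.Theory.
Import numFieldNormedType.Exports.

Local Open Scope classical_set_scope.
Local Open Scope ring_scope.

Section tuple_cons.
Context {d : measure_display} {T : measurableType d} (n : nat).

Definition tuple_cons (x : T * n.-tuple T) : n.+1.-tuple T :=
  [tuple of x.1 :: x.2].

Lemma measurable_tuple_cons : measurable_fun [set: T * n.-tuple T] tuple_cons.
Proof. exact: measurable_cons. Qed.

HB.instance Definition _ :=
  isMeasurableFun.Build _ _ _ _ tuple_cons measurable_tuple_cons.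

End tuple_cons.

(* The centered Gaussian measure on R^d with covariance matrix beta^2 I_d, i.e.
   the d-fold product of the one-dimensional Gaussian measures of mean 0 and
   standard deviation beta; see gaussian_box. *)
Section gaussian_measure.
Context {R : realType}.

Fixpoint gaussian (beta : R) (d : nat) :
    probability (d.-tuple (measurableTypeR R)) R :=
  match d with
  | 0 => \d_([tuple] : 0.-tuple (measurableTypeR R))
  | d'.+1 => distribution (normal_prob 0 beta \x gaussian beta d')%E
                          (@tuple_cons _ _ d')
  end.

Let box (d : nat) (A : 'I_d -> set (measurableTypeR R)) :=
  [set x : d.-tuple (measurableTypeR R) | forall i, A i (tnth x i)].

Let measurable_box d A : (forall i, measurable (A i)) -> measurable (@box d A).
Proof.
move=> mA.
rewrite (_ : box A = \bigcap_(i in [set: 'I_d]) ((fun x => tnth x i) @^-1` A i)).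
  apply: fin_bigcap_measurable => [|i _]; first exact: finite_finset.
  by rewrite -[X in measurable X]setTI; exact: measurable_tnth.
by apply/seteqP; split => x /= Ax i => [_|]; exact: Ax.
Qed.

Lemma gaussian_box (beta : R) (d : nat) (A : 'I_d -> set (measurableTypeR R)) :
  (forall i, measurable (A i)) ->
  gaussian beta d [set x | forall i, A i (tnth x i)] =
  (\big[mule/1]_(i < d) normal_prob 0 beta (A i))%E.
Proof.
elim: d A => [|d IH] A mA.
  rewrite big_ord0 /= diracE mem_set//; by case.
rewrite big_ord_recl /= /distribution /pushforward /=.
rewrite -(IH (fun i => A (lift ord0 i)))// -product_measure1E//; last first.
  exact: (@measurable_box d (fun i => A (lift ord0 i))).
congr (product_measure1 _ _ _); apply/seteqP; split => -[x y] /=.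
  move=> Axy; split => [|i]; first exact: (Axy ord0).
  by have := Axy (lift ord0 i); rewrite tnthS.
by case=> Ax Ay i; case: (unliftP ord0 i) => [j|] ->; rewrite ?tnthS.
Qed.

End gaussian_measure.

(* The library provides L^2(mu) as the quotient type LspaceType2 mu (classes of
   square-integrable functions modulo a.e. equality) without algebraic
   structure; here it gets its structure of real vector space. An element f
   coerces to a representative function, so that equations between such
   functions hold mu-almost everywhere only. *)
Section L2_space.
Context {d : measure_display} {T : measurableType d} {R : realType}.
Variable mu : {measure set T -> \bar R}.
Local Notation L2 := (LspaceType2 mu).
Local Notation MF := {mfun_ mu, T >-> measurableTypeR R}.

Lemma L2_Lfun (f : L2) : (f : T -> R) \in Lfun mu 2%:E.
Proof.
rewrite inE; apply/andP; split; rewrite inE/=; last exact: Lebesgue_finite.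
exact: (measurable_funPT (repr (LebesgueSpace.sort f))).
Qed.

Lemma L2_ae_inj (f g : L2) : f = g %[ae mu] -> f = g.
Proof.
case: f g => f [[fi]] [g [[gi]]] fg.
have {fg}fg : f = g by apply/eqP; rewrite -(reprK f) -(reprK g); apply/ae_eqP.
by rewrite {}fg in fi *; congr LebesgueSpace.Pack; rewrite (Prop_irrelevance fi gi).
Qed.

(* L2_of gL is the class of the square-integrable function g. *)
Section L2_of.
Variables (g : T -> R) (gL : g \in Lfun mu 2%:E).

Let mg : measurable_fun [set: T] (g : T -> measurableTypeR R).
Proof. by move: gL; rewrite inE => /andP[]; rewrite inE. Qed.

Let gm : {mfun T >-> measurableTypeR R} := @mfun_Sub _ _ T (measurableTypeR R) g (mem_set mg).

Let gc : MF := \pi_(MF)%qT gm.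

Let gcE : gc = g %[ae mu].
Proof. by apply/asboolP; rewrite -[asbool _]/(ae_eq_op mu (repr gc) gm) -eqmodE reprK. Qed.

Let gcfin : finite_norm mu 2%:E gc.
Proof.
have : finite_norm mu 2%:E g by move: gL; rewrite inE => /andP[_]; rewrite inE.
rewrite /finite_norm unlock => /le_lt_trans; apply.
rewrite le_eqVlt; apply/orP; left; apply/eqP; congr (_ `^ _)%E.
have mabs (h : T -> R) : measurable_fun [set: T] h ->
    measurable_fun [set: T] (fun x => `|h x| `^ 2).
  move=> mh.
  by apply: (@measurableT_comp _ _ _ _ _ _ (@powR R ^~ 2)) => //; exact: measurableT_comp.
apply: ge0_ae_eq_integral => //.
- by apply/measurable_EFinP; apply: mabs; exact: (measurable_funPT (repr gc)).
- by apply/measurable_EFinP; exact: mabs.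
- by move=> x _; rewrite lee_fin powR_ge0.
- by move=> x _; rewrite lee_fin powR_ge0.
- by apply: filterS gcE => x /= /[apply] ->.
Qed.

Definition L2_of : L2 :=
  LebesgueSpace.Pack (LebesgueSpace.Class (@isFinLebesgue.Build _ _ _ mu _ (lee1n 2) gc gcfin)).

Lemma L2_ofE : L2_of = g %[ae mu].
Proof. exact: gcE. Qed.

End L2_of.

Let submod := @Lfun_submod_closed d T R mu 2%:E (lee1n 2).

Let L2_zero : L2 := L2_of submod.1.

Let addL (f g : L2) : (f : T -> R) + (g : T -> R) \in Lfun mu 2%:E.
Proof. by rewrite -[f : T -> R]scale1r; apply: submod.2; exact: L2_Lfun. Qed.

Let L2_add (f g : L2) : L2 := L2_of (addL f g).

Let scaleL (a : R) (f : L2) : a *: (f : T -> R) \in Lfun mu 2%:E.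
Proof.
by rewrite -[_ *: _]addr0; apply: submod.2; [exact: L2_Lfun|exact: submod.1].
Qed.

Let L2_scale (a : R) (f : L2) : L2 := L2_of (scaleL a f).

Let L2_opp : L2 -> L2 := L2_scale (-1).

Let addE (f g : L2) : \forall x \ae mu, L2_add f g x = f x + g x.
Proof. by apply: filterS (L2_ofE (addL f g)) => x /= /(_ I). Qed.

Let scaleE (a : R) (f : L2) : \forall x \ae mu, L2_scale a f x = a * f x.
Proof. by apply: filterS (L2_ofE (scaleL a f)) => x /= /(_ I). Qed.

Let zeroE : \forall x \ae mu, L2_zero x = 0.
Proof. by apply: filterS (L2_ofE submod.1) => x /= /(_ I). Qed.

Let L2_inj (f g : L2) : (\forall x \ae mu, f x = g x) -> f = g.
Proof. by move=> fg; apply: L2_ae_inj; apply: filterS fg => x + _. Qed.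

Let L2_addA : associative L2_add.
Proof.
move=> f g h; apply: L2_inj.
apply: filterS2 (filterI (addE f (L2_add g h)) (addE g h))
  (filterI (addE (L2_add f g) h) (addE f g)) => x [-> ->] [-> ->].
by rewrite addrA.
Qed.

Let L2_addC : commutative L2_add.
Proof.
move=> f g; apply: L2_inj.
by apply: filterS2 (addE f g) (addE g f) => x -> ->; rewrite addrC.
Qed.

Let L2_add0 : left_id L2_zero L2_add.
Proof.
move=> f; apply: L2_inj.
by apply: filterS2 (addE L2_zero f) zeroE => x -> ->; rewrite add0r.
Qed.

Let L2_addN : left_inverse L2_zero L2_opp L2_add.
Proof.
move=> f; apply: L2_inj.
apply: filterS3 (addE (L2_opp f) f) (scaleE (-1) f) zeroE => x -> -> ->.
by rewrite mulN1r addNr.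
Qed.

HB.instance Definition _ := gen_eqMixin L2.
HB.instance Definition _ := gen_choiceMixin L2.
HB.instance Definition _ :=
  GRing.isZmodule.Build L2 L2_addA L2_addC L2_add0 L2_addN.

Let L2_scaleA a b (f : L2) : L2_scale a (L2_scale b f) = L2_scale (a * b) f.
Proof.
apply: L2_inj.
apply: filterS3 (scaleE a (L2_scale b f)) (scaleE b f) (scaleE (a * b) f).
by move=> x -> -> ->; rewrite mulrA.
Qed.

Let L2_scale1 : left_id 1 L2_scale.
Proof. by move=> f; apply: L2_inj; apply: filterS (scaleE 1 f) => x ->; rewrite mul1r. Qed.

Let L2_scaleDr : right_distributive L2_scale +%R.
Proof.
move=> a f g; apply: L2_inj.
apply: filterS3 (filterI (scaleE a (f + g)) (addE f g))
  (addE (L2_scale a f) (L2_scale a g)) (filterI (scaleE a f) (scaleE a g)).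
by move=> x [-> ->] -> [-> ->]; rewrite mulrDr.
Qed.

Let L2_scaleDl (f : L2) : {morph L2_scale^~ f : a b / a + b}.
Proof.
move=> a b; apply: L2_inj.
apply: filterS3 (scaleE (a + b) f) (addE (L2_scale a f) (L2_scale b f))
  (filterI (scaleE a f) (scaleE b f)) => x -> -> [-> ->].
by rewrite mulrDl.
Qed.

HB.instance Definition _ := GRing.Zmodule_isLmodule.Build R L2
  L2_scaleA L2_scale1 L2_scaleDr L2_scaleDl.

Lemma L2_addE (f g : L2) : \forall x \ae mu, (f + g) x = f x + g x.
Proof. exact: addE. Qed.

Lemma L2_scaleE (a : R) (f : L2) : \forall x \ae mu, (a *: f) x = a * f x.
Proof. exact: scaleE. Qed.

Lemma L2_zeroE : \forall x \ae mu, (0 : L2) x = 0.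
Proof. exact: zeroE. Qed.

End L2_space.


(* Bounded operators on the real Hilbert space L^2(mu). Orthonormal bases are
   indexed by nat: the definitions below are meant for a measure mu such that
   L^2(mu) is separable and infinite-dimensional, e.g. a nondegenerate Gaussian
   measure on R^d with d > 0. *)
Section operators.
Context {d : measure_display} {T : measurableType d} {R : realType}.
Variable mu : {measure set T -> \bar R}.
Local Notation L2 := (LspaceType2 mu).
Implicit Types (f g : L2) (A B S : L2 -> L2) (e : nat -> L2).

Definition L2dot f g : R := \int[mu]_x (f x * g x).

Definition L2norm f : R := Num.sqrt (L2dot f f).

Definition bounded_linear A :=
  linear A /\ exists M : R, forall f, L2norm (A f) <= M * L2norm f.

Definition adjoint_of A B := forall f g, L2dot (A f) g = L2dot f (B g).

Definition self_adjoint A := bounded_linear A /\ adjoint_of A A.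

Definition nonnegative_operator A :=
  self_adjoint A /\ forall f, 0 <= L2dot (A f) f.

Definition orthonormal_basis e :=
  (forall i j, L2dot (e i) (e j) = (i == j)%:R) /\
  (forall f, L2norm (f - \sum_(i < n) L2dot f (e i) *: e i) @[n --> \oo] --> 0).

(* S = |A| = (A^* A)^(1/2), the nonnegative square root of A^* A, with B = A^* *)
Definition absolute_value A S :=
  nonnegative_operator S /\
  exists B, [/\ bounded_linear B, adjoint_of A B & S \o S =1 B \o A].

Definition trace_series A e := series (fun n => L2dot (A (e n)) (e n)).

(* sum_n <|A| e_n, e_n> < +oo for some orthonormal basis (e_n) *)
Definition trace_class A :=
  bounded_linear A /\
  exists2 S, absolute_value A S &
  exists2 e, orthonormal_basis e & cvgn (trace_series S e).

(* tr A = t: the sum of <A e_n, e_n> is t in every orthonormal basis (e_n);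
   meaningful for a trace class A *)
Definition has_trace A (t : R) :=
  forall e, orthonormal_basis e -> trace_series A e @ \oo --> t.

End operators.

(* A bounded measurable kernel K on a probability space defines an operator
   f |-> (s |-> \int K(s,t) f(t) dP(t)) on L^2(P). *)
Section integral_operator.
Context {d : measure_display} {T : measurableType d} {R : realType}.
Variables (P : probability T R) (K : T -> T -> R) (M : R).
Hypothesis mK : measurable_fun [set: T * T] (fun z => K z.1 z.2).
Hypothesis K_le : forall s t, `|K s t| <= M.
Variable f : LspaceType2 P.

Let M0 : 0 <= M. Proof. by apply: le_trans (K_le point point). Qed.

Let mf : measurable_fun [set: T] (f : T -> R).
Proof. by have := L2_Lfun f; rewrite inE => /andP[]; rewrite inE. Qed.

Let f1 : P.-integrable setT (EFin \o f).
Proof.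
apply/Lfun1_integrable; apply: Lfun_subset12 (L2_Lfun f) => //.
exact: fin_num_measure.
Qed.

Let mKf : measurable_fun [set: T * T] (fun z => K z.1 z.2 * f z.2).
Proof. by apply: measurable_funM => //; exact: measurableT_comp. Qed.

Let F (s : T) : R := \int[P]_t (K s t * f t).

Let mKs s : measurable_fun [set: T] (K s).
Proof.
have -> : K s = (fun z => K z.1 z.2) \o (fun t => (s, t)) by [].
by apply: measurableT_comp => //; exact: pair1_measurable.
Qed.

Lemma integrable_kernel s : P.-integrable setT (EFin \o (fun t => K s t * f t)).
Proof.
apply: (@le_integrable _ _ _ P setT _ _ (fun t => (M * f t)%:E)) => //.
- by apply/measurable_EFinP; apply: measurable_funM.
- by move=> t _; rewrite /= lee_fin !normrM ler_wpM2r// (ger0_norm M0).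
- by apply: (integrableZl _ M f1).
Qed.

Lemma integral_kernel_Lfun : F \in Lfun P 2%:E.
Proof.
pose C := \int[P]_t (M * `|f t|).
have abs_int : P.-integrable setT (fun t => (M * `|f t|)%:E).
  by apply: (integrableZl _ M (integrable_norm f1)).
have F_le s : `|F s| <= C.
  apply: le_trans (le_normr_Rintegral _ (integrable_kernel s)) _ => //.
  apply: le_Rintegral => //; first exact: (integrable_norm (integrable_kernel s)).
  by move=> t _; rewrite normrM ler_wpM2r.
have FE s : (F s)%:E = (\int[P]_t (K s t * f t)%:E)%E.
  by rewrite /F /Rintegral fineK//; exact: integrable_fin_num (integrable_kernel s).
have intKf : (P \x P)%E.-integrable setT (fun z => (K z.1 z.2 * f z.2)%:E).
  apply/integrable12ltyP; first exact/measurable_EFinP.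
  apply: (@le_lt_trans _ _ (\int[P]_s (cst C%:E s))%E); last first.
    by rewrite integral_cst// [X in (_ * X)%E]probability_setT mule1 ltry.
  apply: ge0_le_integral => //.
  - by move=> s _; exact: integral_ge0.
  - apply: (measurable_fun_fubini_tonelli_F (fun z => `|(K z.1 z.2 * f z.2)%:E|%E)) => //.
    by apply: measurableT_comp => //; exact/measurable_EFinP.
  - move=> s _ /=; rewrite /C /Rintegral fineK//; last exact: integrable_fin_num.
    apply: ge0_le_integral => //.
    + apply/measurable_EFinP; apply: measurableT_comp => //; exact: measurable_funM.
    + by apply/measurable_EFinP; apply: measurable_funM => //; exact: measurableT_comp.
    + by move=> t _; rewrite /= lee_fin normrM ler_wpM2r.
have mF : measurable_fun [set: T] F.
  apply/measurable_EFinP.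
  rewrite (_ : EFin \o F = fubini_F P (fun z => (K z.1 z.2 * f z.2)%:E)).
    exact: measurable_fubini_F intKf.
  by apply/funext => s /=; rewrite FE.
rewrite inE; apply/andP; split; rewrite inE//=.
rewrite /finite_norm unlock poweR_lty//.
apply: (@le_lt_trans _ _ (\int[P]_s (cst (C `^ 2)%:E s))%E); last first.
  by rewrite integral_cst// [X in (_ * X)%E]probability_setT mule1 ltry.
apply: ge0_le_integral => //.
- by move=> s _; rewrite lee_fin powR_ge0.
- apply/measurable_EFinP; apply: (@measurableT_comp _ _ _ _ _ _ (@powR R ^~ 2)) => //.
  exact: measurableT_comp.
- move=> s _; rewrite /= lee_fin; apply: ge0_ler_powR => //; rewrite nnegrE//.
  exact: le_trans (F_le s).
Qed.

End integral_operator.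

Section euclidean.
Context {R : realType} {d : nat}.
Local Notation E := (d.-tuple (measurableTypeR R)).
Implicit Types s t : E.

Definition dotp s t : R := \sum_(i < d) tnth s i * tnth t i.

Definition enorm s : R := Num.sqrt (dotp s s).

Definition tsub s t : E :=
  [tuple (tnth s i : R) - tnth t i | i < d].

Definition kernelK s t : R :=
  expR (- (enorm (tsub s t) ^+ 2 / 2)) -
  (1 + dotp s t + dotp s t ^+ 2 / 2) *
  expR (- ((enorm s ^+ 2 + enorm t ^+ 2) / 2)).


Let dotp_ge0 s : 0 <= dotp s s.
Proof. by apply: sumr_ge0 => i _; rewrite -expr2 sqr_ge0. Qed.

Lemma enorm_sqr s : enorm s ^+ 2 = dotp s s.
Proof. by rewrite sqr_sqrtr. Qed.

Lemma kernelK_le s t : `|kernelK s t| <= 3.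
Proof.
set u := (enorm s ^+ 2 + enorm t ^+ 2) / 2.
have u0 : 0 <= u by rewrite divr_ge0// addr_ge0// sqr_ge0.
have dot_le : `|dotp s t| <= u.
  rewrite /u !enorm_sqr -big_split/= mulr_suml.
  apply: le_trans (ler_norm_sum _ _ _) _; apply: ler_sum => i _.
  rewrite ler_norml; set a : R := tnth s i; set b : R := tnth t i.
  have := sqr_ge0 (a + b); have := sqr_ge0 (a - b); lra.
have e1 : expR (- (enorm (tsub s t) ^+ 2 / 2)) <= 1.
  by rewrite -expR0 ler_expR oppr_le0 divr_ge0// sqr_ge0.
have e0 := expR_ge0 (- (enorm (tsub s t) ^+ 2 / 2)).
have p2 : `|(1 + dotp s t + dotp s t ^+ 2 / 2) * expR (- u)| <= 2.
  rewrite normrM (ger0_norm (expR_ge0 _)) expRN ler_pdivrMr ?expR_gt0//.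
  have h1 : 1 + u <= expR u := expR_ge1Dx u.
  have h2 : 1 + u ^+ 2 / 2 <= expR u := expR_ge1Dxn 1 u0.
  have h3 : dotp s t ^+ 2 <= u ^+ 2 by rewrite -[leLHS]real_normK ?num_real// lerXn2r// nnegrE.
  have h4 := sqr_ge0 (dotp s t).
  move: dot_le; rewrite !ler_norml => /andP[? ?]; apply/andP; split; lra.
rewrite /kernelK -/u; move: p2; rewrite !ler_norml => /andP[? ?].
by apply/andP; split; lra.
Qed.

Lemma measurable_kernelK :
  measurable_fun [set: E * E] (fun z : E * E => kernelK z.1 z.2).
Proof.
have m1 i : measurable_fun [set: E * E] (fun z : E * E => tnth z.1 i : R).
  exact: measurableT_comp (measurable_tnth i) measurable_fst.
have m2 i : measurable_fun [set: E * E] (fun z : E * E => tnth z.2 i : R).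
  exact: measurableT_comp (measurable_tnth i) measurable_snd.
have mdot : measurable_fun [set: E * E] (fun z : E * E => dotp z.1 z.2).
  by apply: measurable_sum => i; exact: measurable_funM.
have mn1 : measurable_fun [set: E * E] (fun z : E * E => enorm z.1 ^+ 2).
  under eq_fun do rewrite enorm_sqr.
  by apply: measurable_sum => i; exact: measurable_funM.
have mn2 : measurable_fun [set: E * E] (fun z : E * E => enorm z.2 ^+ 2).
  under eq_fun do rewrite enorm_sqr.
  by apply: measurable_sum => i; exact: measurable_funM.
have mn3 : measurable_fun [set: E * E] (fun z : E * E => enorm (tsub z.1 z.2) ^+ 2).
  under eq_fun do rewrite enorm_sqr.
  apply: measurable_sum => i; under eq_fun do rewrite tnth_mktuple.
  by apply: measurable_funM; exact: measurable_funB.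
apply: measurable_funB.
  apply: measurableT_comp => //; apply: measurableT_comp => //.
  by apply: measurable_funM.
apply: measurable_funM.
  apply: measurable_funD; first exact: measurable_funD.
  by apply: measurable_funM => //; exact: measurable_funX.
apply: measurableT_comp => //; apply: measurableT_comp => //.
by apply: measurable_funM => //; exact: measurable_funD.
Qed.

End euclidean.

Section operatorA.
Context {R : realType} (beta : R) (d : nat).

Definition operatorA (f : LspaceType2 (gaussian beta d)) :
    LspaceType2 (gaussian beta d) :=
  L2_of (integral_kernel_Lfun measurable_kernelK kernelK_le f).

Lemma integrable_operatorA (f : LspaceType2 (gaussian beta d)) s :
  (gaussian beta d).-integrable setT (EFin \o (fun t => kernelK s t * f t)).
Proof. exact: integrable_kernel measurable_kernelK kernelK_le f s. Qed.

Lemma operatorAE (f : LspaceType2 (gaussian beta d)) :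
  \forall s \ae gaussian beta d,
    operatorA f s = \int[gaussian beta d]_t (kernelK s t * f t).
Proof.
by have := L2_ofE (integral_kernel_Lfun measurable_kernelK kernelK_le f);
  apply: filterS => s /= /(_ I).
Qed.

End operatorA.

(* Main.v *)
(* Expanding exp (s . t) in K and each power (s . t)^n over the words w in
   {1, ..., d}^n gives K(s,t) = sum over words of length >= 3 of
   phi_w(s) phi_w(t), where phi_w(s) = s^w exp(-|s|^2/2) / sqrt(n!). All partial
   sums are bounded by 1 in absolute value, so by dominated convergence
   <A f, g> = sum_w <f, phi_w> <g, phi_w>. Hence A is self-adjoint and
   nonnegative, |A| = A, and by Parseval its trace in any orthonormal basis is
   sum_w |phi_w|^2 = E[K(X,X)]; the latter is computed by differentiating
   E[exp(-c |X|^2)] = (1 + 2 c beta^2)^(-d/2) twice at c = 1.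

   Both injectivity and the existence of an orthonormal basis rest on the
   totality of the phi_w with |w| >= 3: given a closed subspace S containing
   them, the bounded functions which multiply the family
   V = {g bounded | for all |w| >= 3, phi_w g is in S} into itself form an
   algebra closed under bounded pointwise limits. By power series it contains
   the functions exp(-(t_i - y)^2/8), hence the indicators of slabs, hence those
   of all measurable sets. Since phi_w is nonzero almost everywhere for
   w = (i,i,i,i), all of L^2 is obtained by approximating f / phi_w with simple
   functions. *)
Require Import Defs.
From mathcomp Require Import all_boot all_order all_algebra.
From mathcomp Require Import all_classical all_reals all_analysis.
From mathcomp Require Import measurable_realfun ring lra.

Set Implicit Arguments.
Unset Strict Implicit.
Unset Printing Implicit Defensive.
Import Order.TTheory GRing.Theory Num.Theory.
Import numFieldNormedType.Exports.

Local Open Scope classical_set_scope.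
Local Open Scope ring_scope.

(** * The inner product of L^2 *)

Section dominated_Rintegral.
Context {d : measure_display} {T : measurableType d} {R : realType}.
Variable mu : {measure set T -> \bar R}.

Lemma cvg_dominated_Rintegral (f_ : nat -> T -> R) (f G : T -> R) :
  (forall n, measurable_fun setT (f_ n)) -> measurable_fun setT f ->
  (\forall x \ae mu, f_ n x @[n --> \oo] --> f x) ->
  mu.-integrable setT (EFin \o G) ->
  (forall n x, `|f_ n x| <= G x) ->
  \int[mu]_x f_ n x @[n --> \oo] --> \int[mu]_x f x.
Proof.
move=> mf_ mf f_f iG f_G.
have mEf_ n : measurable_fun setT (EFin \o f_ n) by exact/measurable_EFinP.
have mEf : measurable_fun setT (EFin \o f) by exact/measurable_EFinP.
have cE : \forall x \ae mu, setT x -> (EFin \o f_ n) x @[n --> \oo] --> (EFin \o f) x.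
  by apply: filterS f_f => x fx _; apply: cvg_EFin; [exact: nearW|exact: fx].
have leE : \forall x \ae mu, forall n, setT x ->
    (`|(EFin \o f_ n) x| <= (EFin \o G) x)%E.
  by apply: aeW => x n _; rewrite /= lee_fin.
have [intf _ cvg] := dominated_convergence measurableT mEf_ mEf cE iG leE.
have intfE : (\int[mu]_x (EFin \o f) x = (\int[mu]_x f x)%:E)%E.
  by rewrite fineK//; exact: integrable_fin_num intf.
by move: cvg; rewrite intfE => /fine_cvgP[_]; exact.
Qed.

End dominated_Rintegral.

Section L2_inner_product.
Context {d : measure_display} {T : measurableType d} {R : realType}.
Variable mu : {measure set T -> \bar R}.
Local Notation L2 := (LspaceType2 mu).
Local Notation dot := (@L2dot _ _ _ mu).
Local Notation norm := (@L2norm _ _ _ mu).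
Implicit Types (f g h : L2) (a : R).

Lemma Lfun2_measurable (f : T -> R) :
  f \in Lfun mu 2%:E -> measurable_fun setT f.
Proof. by rewrite inE => /andP[]; rewrite inE. Qed.

Lemma L2_measurable f : measurable_fun setT (f : T -> R).
Proof. exact: Lfun2_measurable (L2_Lfun f). Qed.

Lemma Lfun2_mul_integrable (f g : T -> R) : f \in Lfun mu 2%:E ->
  g \in Lfun mu 2%:E -> mu.-integrable setT (EFin \o (fun x => f x * g x)).
Proof. by move=> fL gL; apply/Lfun1_integrable; exact: Lfun2_mul_Lfun1. Qed.

Lemma ae_eq_Rintegral (f g : T -> R) : measurable_fun setT f ->
  measurable_fun setT g -> (\forall x \ae mu, f x = g x) ->
  \int[mu]_x f x = \int[mu]_x g x.
Proof.
move=> mf mg fg; congr fine; apply: ae_eq_integral => //.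
- exact/measurable_EFinP.
- exact/measurable_EFinP.
- by apply: filterS fg => x /= ->.
Qed.

Lemma L2dotC f g : dot f g = dot g f.
Proof. by apply: eq_Rintegral => x _; rewrite mulrC. Qed.

Lemma L2_ofP (g : T -> R) (gL : g \in Lfun mu 2%:E) :
  \forall x \ae mu, L2_of gL x = g x.
Proof. by apply: filterS (L2_ofE gL) => x /= /(_ I). Qed.

(** Any representative computes the inner product, so the choice hidden in [L2_of] disappears from
    all later integrals. *)
Lemma L2dot_of (g : T -> R) (gL : g \in Lfun mu 2%:E) f :
  dot (L2_of gL) f = \int[mu]_x (g x * f x).
Proof.
apply: ae_eq_Rintegral.
- by apply: measurable_funM; exact: L2_measurable.
- by apply: measurable_funM; [exact: Lfun2_measurable|exact: L2_measurable].
- by apply: filterS (L2_ofP gL) => x ->.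
Qed.

Lemma L2dotDl f g h : dot (f + g) h = dot f h + dot g h.
Proof.
rewrite -RintegralD//; try exact: Lfun2_mul_integrable (L2_Lfun _) (L2_Lfun _).
apply: ae_eq_Rintegral.
- by apply: measurable_funM; exact: L2_measurable.
- by apply: measurable_funD; apply: measurable_funM; exact: L2_measurable.
- by apply: filterS (L2_addE f g) => x ->; rewrite mulrDl.
Qed.

Lemma L2dotZl a f g : dot (a *: f) g = a * dot f g.
Proof.
rewrite -RintegralZl//; try exact: Lfun2_mul_integrable (L2_Lfun _) (L2_Lfun _).
apply: ae_eq_Rintegral.
- by apply: measurable_funM; exact: L2_measurable.
- by do 2?apply: measurable_funM => //; exact: L2_measurable.
- by apply: filterS (L2_scaleE a f) => x ->; rewrite mulrA.
Qed.

Lemma L2dotDr f g h : dot h (f + g) = dot h f + dot h g.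
Proof. by rewrite !(L2dotC h) L2dotDl. Qed.

Lemma L2dotZr a f g : dot g (a *: f) = a * dot g f.
Proof. by rewrite !(L2dotC g) L2dotZl. Qed.

Lemma L2dot0l f : dot 0 f = 0.
Proof. by rewrite -(scale0r (0 : L2)) L2dotZl mul0r. Qed.

Lemma L2dot0r f : dot f 0 = 0.
Proof. by rewrite L2dotC L2dot0l. Qed.

Lemma L2dotNl f g : dot (- f) g = - dot f g.
Proof. by rewrite -scaleN1r L2dotZl mulN1r. Qed.

Lemma L2dotNr f g : dot f (- g) = - dot f g.
Proof. by rewrite L2dotC L2dotNl L2dotC. Qed.

Lemma L2dotBl f g h : dot (f - g) h = dot f h - dot g h.
Proof. by rewrite L2dotDl L2dotNl. Qed.

Lemma L2dotBr f g h : dot h (f - g) = dot h f - dot h g.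
Proof. by rewrite L2dotDr L2dotNr. Qed.

Lemma L2dot_suml (I : Type) (r : seq I) (F : I -> L2) g :
  dot (\sum_(i <- r) F i) g = \sum_(i <- r) dot (F i) g.
Proof.
by apply: (big_ind2 (fun u v => dot u g = v)) => [|u x v y <- <-|//];
  rewrite ?L2dot0l ?L2dotDl.
Qed.

Lemma L2dot_ge0 f : 0 <= dot f f.
Proof. by apply: Rintegral_ge0 => x _; rewrite -expr2 sqr_ge0. Qed.

(** The integrand [f x * f x] is nonnegative, so a zero integral makes it vanish almost everywhere,
    and classes that agree almost everywhere are equal. *)
Lemma L2dot_eq0 f : dot f f = 0 -> f = 0.
Proof.
move=> ff0; apply: L2_ae_inj.
have ifin := Lfun2_mul_integrable (L2_Lfun f) (L2_Lfun f).
have : (\int[mu]_x `|(f x * f x)%:E|)%E = 0%E.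
  rewrite -[RHS]/(0%:E) -ff0 /L2dot /Rintegral fineK; last exact: integrable_fin_num.
  by apply: eq_integral => x _; rewrite gee0_abs// lee_fin -expr2 sqr_ge0.
move/ae_eq_integral_abs => /= -/(_ measurableT).
have mff : measurable_fun setT (fun x => (f x * f x)%:E).
  by apply/measurable_EFinP; apply: measurable_funM; exact: L2_measurable.
move=> /(_ mff) h; apply: filterS2 h (L2_zeroE mu) => x /= fx -> _.
by have /eqP := fx I; rewrite eqe -expr2 sqrf_eq0 => /eqP.
Qed.

(** Lets identities between classes be tested weakly; linearity of the operator is obtained this
    way. *)
Lemma L2dot_inj f g : (forall h, dot f h = dot g h) -> f = g.
Proof.
move=> fg; apply/eqP; rewrite -subr_eq0; apply/eqP/L2dot_eq0.
by rewrite L2dotBl fg subrr.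
Qed.

Lemma sqr_L2norm f : norm f ^+ 2 = dot f f.
Proof. by rewrite sqr_sqrtr// L2dot_ge0. Qed.

Lemma L2norm_ge0 f : 0 <= norm f.
Proof. exact: sqrtr_ge0. Qed.

Lemma L2norm0 : norm 0 = 0.
Proof. by rewrite /L2norm L2dot0l sqrtr0. Qed.

Lemma L2norm_eq0 f : norm f = 0 -> f = 0.
Proof. by move=> f0; apply: L2dot_eq0; rewrite -sqr_L2norm f0 expr0n. Qed.

Lemma L2norm_le f c : 0 <= c -> dot f f <= c ^+ 2 -> norm f <= c.
Proof. by move=> c0 /ler_wsqrtr; rewrite sqrtr_sqr ger0_norm. Qed.

Lemma L2_CauchySchwarz f g : `|dot f g| <= norm f * norm g.
Proof.
have [g0|gN0] := eqVneq (norm g) 0.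
  by rewrite (L2norm_eq0 g0) L2dot0r L2norm0 normr0 mulr0.
have gg0 : 0 < dot g g by rewrite -sqr_L2norm exprn_even_gt0.
rewrite -ler_sqr ?nnegrE ?mulr_ge0 ?L2norm_ge0// exprMn !sqr_L2norm real_normK ?num_real//.
(* The squared norm of [<g,g> f - <f,g> g] factors as [<g,g> (<f,f> <g,g> - <f,g>^2)]. *)
have := L2dot_ge0 (dot g g *: f - dot f g *: g).
rewrite !(L2dotBl, L2dotBr, L2dotZl, L2dotZr) (L2dotC g f).
set x := dot f f; set y := dot f g; set z := dot g g.
rewrite (_ : _ - _ = z * (x * z - y ^+ 2)); last by ring.
by rewrite pmulr_rge0// subr_ge0.
Qed.

Lemma L2norm_triangle f g : norm (f + g) <= norm f + norm g.
Proof.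
apply: L2norm_le; first by rewrite addr_ge0 ?L2norm_ge0.
rewrite !(L2dotDl, L2dotDr) (L2dotC g f) sqrrD !sqr_L2norm.
have := L2_CauchySchwarz f g; rewrite ler_norml => /andP[_]; lra.
Qed.

Lemma L2normZ a f : norm (a *: f) = `|a| * norm f.
Proof. by rewrite /L2norm L2dotZl L2dotZr mulrA -expr2 sqrtrM ?sqr_ge0// sqrtr_sqr. Qed.

End L2_inner_product.

(** * Orthonormal bases *)

(** A limsup argument: for each [eps], [u] stays below a constant smaller than [eps] plus a null
    sequence. *)
Lemma cvg0_le_add {R : realType} (u : nat -> R) : (forall n, 0 <= u n) ->
  (forall eps : R, 0 < eps -> exists (a : R) (v : nat -> R),
    [/\ a < eps, v n @[n --> \oo] --> 0 & forall n, u n <= a + v n]) ->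
  u n @[n --> \oo] --> 0.
Proof.
move=> u0 H; apply/cvgrPdist_lt => eps eps0.
have [a [v [aeps v0 uv]]] := H _ eps0.
have /cvgrPdist_lt/(_ (eps - a)) := v0; rewrite subr_gt0 => /(_ aeps).
apply: filterS => n; rewrite !sub0r !normrN (ger0_norm (u0 n)) => /ltr_normlW.
by have := uv n; lra.
Qed.

Section orthonormal_bases.
Context {d : measure_display} {T : measurableType d} {R : realType}.
Variable mu : {measure set T -> \bar R}.
Local Notation L2 := (LspaceType2 mu).
Local Notation dot := (@L2dot _ _ _ mu).
Local Notation norm := (@L2norm _ _ _ mu).
Implicit Types (f g h : L2) (a : R) (e : nat -> L2).

Record closed_subspace (P : set L2) : Prop := ClosedSubspace {
  closed_subspaceD : forall f g, P f -> P g -> P (f + g);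
  closed_subspaceZ : forall a f, P f -> P (a *: f);
  closed_subspace_cvg : forall f,
    (forall eps, 0 < eps -> exists2 g, P g & norm (f - g) < eps) -> P f }.

(** For nonempty [X] this is density of its linear span, phrased as an induction principle over
    closed subspaces. *)
Definition L2_total (X : set L2) :=
  forall P : set L2, closed_subspace P -> X `<=` P -> forall f, P f.

Definition orthonormal_upto e (n : nat) :=
  forall i j, (i < n)%N -> (j < n)%N -> dot (e i) (e j) = (i == j)%:R.

Definition L2proj e n f : L2 := \sum_(i < n) dot f (e i) *: e i.

Lemma orthonormal_le e m n : (m <= n)%N -> orthonormal_upto e n -> orthonormal_upto e m.
Proof. by move=> mn en i j im jm; apply: en; exact: leq_trans mn. Qed.

Lemma projD e n f g : L2proj e n (f + g) = L2proj e n f + L2proj e n g.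
Proof. by rewrite -big_split; apply: eq_bigr => i _; rewrite L2dotDl scalerDl. Qed.

Lemma projZ e n a f : L2proj e n (a *: f) = a *: L2proj e n f.
Proof. by rewrite scaler_sumr; apply: eq_bigr => i _; rewrite L2dotZl scalerA. Qed.

Lemma projB e n f g : L2proj e n (f - g) = L2proj e n f - L2proj e n g.
Proof. by rewrite projD -scaleN1r projZ scaleN1r. Qed.

Lemma dot_proj e n f j : orthonormal_upto e n -> (j < n)%N ->
  dot (L2proj e n f) (e j) = dot f (e j).
Proof.
move=> en jn; rewrite L2dot_suml (bigD1 (Ordinal jn))//= L2dotZl en// eqxx mulr1.
rewrite big1 ?addr0// => i /eqP/val_eqP/= ij.
by rewrite L2dotZl en// (negbTE ij) mulr0.
Qed.

(** Pythagoras: the residual is orthogonal to the projection. *)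
Lemma dot_sub_proj e n f : orthonormal_upto e n ->
  dot (f - L2proj e n f) (f - L2proj e n f) = dot f f - \sum_(i < n) dot f (e i) ^+ 2.
Proof.
move=> en.
have h g : dot (L2proj e n f) g = \sum_(i < n) dot f (e i) * dot g (e i).
  by rewrite L2dot_suml; apply: eq_bigr => i _; rewrite L2dotZl (L2dotC (e i)).
have hf : dot (L2proj e n f) f = \sum_(i < n) dot f (e i) ^+ 2 by rewrite h.
have hp : dot (L2proj e n f) (L2proj e n f) = \sum_(i < n) dot f (e i) ^+ 2.
  by rewrite h; apply: eq_bigr => i _; rewrite dot_proj.
by rewrite L2dotBl !L2dotBr (L2dotC f (L2proj _ _ _)) hf hp subrr subr0.
Qed.

Lemma Bessel e n f : orthonormal_upto e n -> \sum_(i < n) dot f (e i) ^+ 2 <= dot f f.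
Proof. by move=> en; rewrite -subr_ge0 -dot_sub_proj// L2dot_ge0. Qed.

Lemma norm_sub_proj e n f : orthonormal_upto e n -> norm (f - L2proj e n f) <= norm f.
Proof.
move=> en; apply: L2norm_le; first exact: L2norm_ge0.
rewrite sqr_L2norm dot_sub_proj// gerBl sumr_ge0// => i _; exact: sqr_ge0.
Qed.

(** By Pythagoras the first [m] coefficients already carry the whole squared norm of [f], so the
    residual for [n] has squared norm at most 0. *)
Lemma proj_id_le e m n f : (m <= n)%N -> orthonormal_upto e n ->
  f = L2proj e m f -> f = L2proj e n f.
Proof.
move=> mn en fm; apply/eqP; rewrite -subr_eq0; apply/eqP/L2dot_eq0.
have := dot_sub_proj f (orthonormal_le mn en).
rewrite -fm subrr L2dot0l => /esym/eqP; rewrite subr_eq0 => /eqP fs.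
apply/eqP; rewrite eq_le L2dot_ge0 andbT dot_sub_proj// subr_le0 {}fs.
rewrite -!(big_mkord xpredT (fun i => dot f (e i) ^+ 2)) (big_cat_nat (leq0n m) mn)/=.
by rewrite lerDl sumr_ge0// => i _; exact: sqr_ge0.
Qed.

Lemma orthonormal_basisP e : (forall n, orthonormal_upto e n) ->
  orthonormal_basis e <-> forall f, norm (f - L2proj e n f) @[n --> \oo] --> 0.
Proof.
move=> en; split => [[]//|h]; split => // i j.
by apply: (en (maxn i j).+1); rewrite ltnS ?leq_maxl ?leq_maxr.
Qed.

Lemma Parseval e f : orthonormal_basis e ->
  \sum_(i < n) dot f (e i) ^+ 2 @[n --> \oo] --> dot f f.
Proof.
move=> [eE ef]; have en n : orthonormal_upto e n by move=> i j _ _; exact: eE.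
rewrite -[X in _ --> X](_ : dot f f - 0 * 0 = _); last by rewrite mul0r subr0.
rewrite (_ : (fun n => _) = (fun n => dot f f - norm (f - L2proj e n f) ^+ 2)).
  apply: cvgB; first exact: cvg_cst.
  by apply: cvgM; exact: ef.
by apply/funext => n; rewrite sqr_L2norm dot_sub_proj// opprB addrCA subrr addr0.
Qed.

(** Taking residuals is linear and a contraction, so the residual of a norm limit [f] is at most
    [norm (f - g)] plus the residual of an approximant [g]. *)
Lemma closed_subspace_proj_cvg e : (forall n, orthonormal_upto e n) ->
  closed_subspace [set f | norm (f - L2proj e n f) @[n --> \oo] --> 0].
Proof.
move=> en; split => [f g fP gP|a f fP|f fP] /=.
- apply: (@squeeze_cvgr _ _ _ _ (cst 0)
    (fun n => norm (f - L2proj e n f) + norm (g - L2proj e n g))).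
  + by apply: nearW => n; rewrite L2norm_ge0 projD opprD addrACA L2norm_triangle.
  + exact: cvg_cst.
  + rewrite -[X in _ --> X](addr0 (0 : R)); apply: cvgD; [exact: fP|exact: gP].
- rewrite (_ : (fun n => _) = (fun n => `|a| * norm (f - L2proj e n f))).
    by rewrite -[X in _ --> X](mulr0 `|a|); apply: cvgM => //; exact: cvg_cst.
  by apply/funext => n; rewrite projZ -scalerBr L2normZ.
- apply: (@cvg0_le_add R (fun n => norm (f - L2proj e n f))) => [n|eps eps0].
    exact: L2norm_ge0.
  have [g gP fg] := fP _ eps0.
  exists (norm (f - g)), (fun n => norm (g - L2proj e n g)); split => // n.
  have -> : f - L2proj e n f = (f - g - L2proj e n (f - g)) + (g - L2proj e n g).
    by rewrite projB opprB [RHS]addrACA subrK (addrAC (L2proj e n g)) subrr add0r.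
  apply: le_trans (L2norm_triangle _ _) _; apply: lerD (lexx _).
  exact: norm_sub_proj.
Qed.

Lemma closed_subspace_proj e n : orthonormal_upto e n ->
  closed_subspace [set f | f = L2proj e n f].
Proof.
move=> en; split => [f g fP gP|a f fP|f fP] /=.
- by rewrite projD -fP -gP.
- by rewrite projZ -fP.
- apply/eqP; rewrite -subr_eq0; apply/eqP/L2norm_eq0/eqP.
  rewrite eq_le L2norm_ge0 andbT; apply/ler_addgt0Pr => eps eps0; rewrite add0r.
  have [g /= gP fg] := fP _ eps0.
  (* As [g] is its own projection, the residual of [f] is that of [f - g]. *)
  rewrite (_ : f - _ = f - g - L2proj e n (f - g)); last first.
    by rewrite projB -gP opprB addrA subrK.
  by rewrite (le_trans (norm_sub_proj _ _))// ltW.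
Qed.

(** Double counting of the squared coefficients [dot (u j) (e i) ^+ 2]: they sum to 1 over [i],
    since [e] spans, and to at most 1 over [j], by Bessel. *)
Lemma orthonormal_card_le e n (u : nat -> L2) m : orthonormal_upto e n ->
  orthonormal_upto u m -> (forall f, f = L2proj e n f) -> (m <= n)%N.
Proof.
move=> en um full; rewrite -(ler_nat R).
have sumu : \sum_(j < m) \sum_(i < n) dot (u j) (e i) ^+ 2 = m%:R.
  rewrite (eq_bigr (fun=> 1)) ?sumr_const ?card_ord// => j _.
  have := dot_sub_proj (u j) en; rewrite -full subrr L2dot0l.
  by rewrite um// eqxx => /esym/eqP; rewrite subr_eq0 => /eqP.
rewrite -sumu exchange_big/= -[leRHS]mulr1 -[n in leRHS]card_ord mulr_natl -sumr_const.
apply: ler_sum => i _; have <- : dot (e i) (e i) = 1 by rewrite en ?eqxx.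
have -> : \sum_(j < m) dot (u j) (e i) ^+ 2 = \sum_(j < m) dot (e i) (u j) ^+ 2.
  by apply: eq_bigr => j _; rewrite L2dotC.
exact: Bessel.
Qed.

Lemma closed_subspace_orth f : closed_subspace [set g | dot f g = 0].
Proof.
split => [g h /= fg fh|a g /= fg|g /= gP].
- by rewrite L2dotDr fg fh addr0.
- by rewrite L2dotZr fg mulr0.
- apply/eqP; rewrite -normr_eq0 eq_le normr_ge0 andbT.
  apply/ler_addgt0Pr => eps eps0; rewrite add0r.
  (* The added 1 keeps the divisor positive even when [f] is zero. *)
  have f1 : 0 < norm f + 1 by rewrite ltr_pwDr// L2norm_ge0.
  have [h /= fh gh] := gP _ (divr_gt0 eps0 f1).
  have -> : dot f g = dot f (g - h) by rewrite L2dotBr fh subr0.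
  apply: le_trans (L2_CauchySchwarz _ _) _.
  apply: (@le_trans _ _ ((norm f + 1) * (eps / (norm f + 1)))).
    by apply: ler_pM; rewrite ?L2norm_ge0// ?lerDl// ltW.
  by rewrite mulrC divfK// gt_eqF.
Qed.

(** * Gram-Schmidt orthonormalization of a sequence *)

Section gram_schmidt.
Variable x : nat -> L2.
Hypothesis x_inf : forall e n, orthonormal_upto e n -> exists m, x m != L2proj e n (x m).

(** With [n] the current length, [v] is a unit vector that extends the family and brings [x n] into
    its span. Orthonormality is a premise inside the relation, so that every [en] has some [v] and
    choice applies. *)
Let next (en : (nat -> L2) * nat) (v : L2) := orthonormal_upto en.1 en.2 ->
  [/\ forall i, (i < en.2)%N -> dot v (en.1 i) = 0, dot v v = 1 &
      x en.2 = L2proj en.1 en.2 (x en.2) + dot (x en.2) v *: v].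

Let residual e n m : orthonormal_upto e n -> x m != L2proj e n (x m) ->
  exists v, [/\ forall i, (i < n)%N -> dot v (e i) = 0, dot v v = 1 &
                x m = L2proj e n (x m) + dot (x m) v *: v].
Proof.
move=> en; rewrite -subr_eq0; set r := x m - _ => r0.
have nr0 : norm r != 0 by apply: contra_neq r0; exact: L2norm_eq0.
have re i : (i < n)%N -> dot r (e i) = 0 by move=> ni; rewrite L2dotBl dot_proj ?subrr.
have rp : dot (L2proj e n (x m)) r = 0.
  by rewrite L2dot_suml big1// => i _; rewrite L2dotZl (L2dotC (e _)) re ?mulr0.
have rr : dot r r = dot (x m) r by rewrite [LHS]L2dotBl rp subr0.
exists ((norm r)^-1 *: r); split.
- by move=> i ni; rewrite L2dotZl re ?mulr0.
- by rewrite L2dotZl L2dotZr -sqr_L2norm expr2 mulKf// mulVf.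
- rewrite L2dotZr -rr -sqr_L2norm scalerA expr2 mulKf// mulfV// scale1r.
  by rewrite addrC subrK.
Qed.

Let next_ex en : exists v, next en v.
Proof.
case: en => e n; rewrite /next/=.
have [en|nen] := pselect (orthonormal_upto e n); last by exists 0.
have [xn|xn] := eqVneq (x n) (L2proj e n (x n)); last first.
  by have [v vP] := residual en xn; exists v.
(* Here [x n] is already in the span: the new direction comes from another [x m], and it is
   orthogonal to [x n]. *)
have [m /(residual en)[v [ve vv _]]] := x_inf en.
exists v => _; split => //; rewrite [in X in _ + X]xn L2dot_suml big1 ?scale0r ?addr0//.
by move=> i _; rewrite L2dotZl (L2dotC (e _)) ve ?mulr0.
Qed.

Lemma gram_schmidt : exists2 e, forall n, orthonormal_upto e n &
  forall m, exists n, x m = L2proj e n (x m).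
Proof.
have [nx nxP] := choice next_ex.
(* [st n] is the family after [n] stages, with 0 from index [n] on. Entry [i] is final from stage
   [i.+1], where [e] reads it. *)
pose st := fix st n := if n is n'.+1
  then fun i => if i == n' then nx (st n', n') else st n' i else fun=> 0.
pose e i := st i.+1 i.
have ste n i : (i < n)%N -> st n i = e i.
  elim: n => // n IH; rewrite ltnS leq_eqVlt => /orP[/eqP->//|lt_in].
  by rewrite /= ltn_eqF// IH.
have st_orth n : orthonormal_upto (st n) n <-> orthonormal_upto e n.
  by split => h i j ni nj; have := h i j ni nj; rewrite !ste.
have st_proj n f : L2proj (st n) n f = L2proj e n f.
  by apply: eq_bigr => i _; rewrite ste.
have eE n : e n = nx (st n, n) by rewrite /e /= eqxx.
have en : forall n, orthonormal_upto e n.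
  elim=> [//|n IH]; have [ve vv _] := nxP (st n, n) ((st_orth n).2 IH).
  rewrite -eE /= in ve vv.
  have vej i : (i < n)%N -> dot (e n) (e i) = 0 by move=> ni; have := ve i ni; rewrite ste.
  move=> i j; rewrite !ltnS [in X in X -> _]leq_eqVlt [in X in _ -> X -> _]leq_eqVlt.
  move=> /orP[/eqP->|ni] /orP[/eqP->|nj].
  - by rewrite vv eqxx.
  - by rewrite vej// gtn_eqF.
  - by rewrite L2dotC vej// ltn_eqF.
  - exact: IH.
exists e => // m; exists m.+1.
have [_ _] := nxP (st m, m) ((st_orth m).2 (en m)).
by rewrite /= -eE st_proj {2}/L2proj big_ord_recr.
Qed.

End gram_schmidt.

(** The family [u] certifies infinite dimension: if finitely many orthonormal vectors spanned all
    [x m], they would span everything by totality, and [n.+1] vectors of [u] would fit into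
    dimension [n]. So Gram-Schmidt never stops. *)
Lemma orthonormal_basis_exists (x u : nat -> L2) : L2_total (range x) ->
  (forall n, orthonormal_upto u n) -> exists e, orthonormal_basis e.
Proof.
move=> tx un; have [e n en|e en ex] := @gram_schmidt x.
  apply: contrapT => /forallNP xe.
  have full f : f = L2proj e n f.
    apply: (tx _ (closed_subspace_proj en)) => _ [m _ <-] /=.
    by apply/eqP; apply: contrapT => /negP; exact: xe.
  by have := orthonormal_card_le en (un n.+1) full; rewrite ltnn.
exists e; apply/(orthonormal_basisP en).
apply: (tx _ (closed_subspace_proj_cvg en)) => _ [m _ <-] /=.
(* From index [n] on the residual of [x m] is exactly zero. *)
have [n xm] := ex m; apply: cvg_near_cst; exists n => // k /= nk.
by rewrite -(proj_id_le nk (en k) xm) subrr L2norm0.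
Qed.

End orthonormal_bases.

(** * Partial sums of the exponential series *)

Section exponential_partial_sums.
Context {R : realType}.
Implicit Types x : R.

Lemma cvg_sum_exp_coeff x : \sum_(0 <= k < n) exp_coeff x k @[n --> \oo] --> expR x.
Proof. exact: is_cvg_series_exp_coeff. Qed.

(** The bound is uniform in [m] and [n]; it is the source of domination for the bump functions and
    for the kernel. *)
Lemma norm_sum_exp_coeff_le x m n : `|\sum_(m <= k < n) exp_coeff x k| <= expR `|x|.
Proof.
apply: le_trans (ler_norm_sum _ _ _) _.
rewrite (eq_bigr (exp_coeff `|x|)); last first.
  by move=> k _; rewrite /exp_coeff/= normrM normrX (ger0_norm (_ : 0 <= _^-1)).
apply: (@le_trans _ _ (\sum_(0 <= k < n) exp_coeff `|x| k)).
  have [mn|nm] := leqP m n; last first.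
    by rewrite big_geq ?(ltnW nm)// sumr_ge0// => k _; exact: exp_coeff_ge0.
  rewrite [leRHS](big_cat_nat (leq0n m) mn)/= lerDr sumr_ge0// => k _.
  exact: exp_coeff_ge0.
apply: nondecreasing_cvgn_le (is_cvg_series_exp_coeff _) n => i j ij.
rewrite /series/= (big_cat_nat (leq0n i) ij)/= lerDl sumr_ge0// => k _.
exact: exp_coeff_ge0.
Qed.

End exponential_partial_sums.

(** * Domination and convergence in mean square *)

Section Lfun2_domination.
Context {d : measure_display} {T : measurableType d} {R : realType}.
Variable mu : {measure set T -> \bar R}.

Lemma Lfun2_le (g G : T -> R) : measurable_fun setT g -> G \in Lfun mu 2%:E ->
  (forall t, `|g t| <= `|G t|) -> g \in Lfun mu 2%:E.
Proof.
move=> mg GL gG; have mG := Lfun2_measurable GL.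
have mabs (h : T -> R) : measurable_fun setT h ->
    measurable_fun setT (fun x => (`|h x| `^ 2)%:E).
  move=> mh; apply/measurable_EFinP.
  by apply: (@measurableT_comp _ _ _ _ _ _ (@powR R ^~ 2)) => //; exact: measurableT_comp.
rewrite inE; apply/andP; split; rewrite inE//=.
have : finite_norm mu 2%:E G by move: GL; rewrite inE => /andP[_]; rewrite inE.
rewrite /finite_norm unlock; apply: le_lt_trans.
have i0 (h : T -> R) : (0 <= \int[mu]_x (`|h x| `^ 2)%:E)%E.
  by apply: integral_ge0 => x _; rewrite lee_fin powR_ge0.
apply: gt0_ler_poweR; [by rewrite invr_ge0|by rewrite in_itv/= i0 leey..|].
apply: ge0_le_integral.
- exact: measurableT.
- by move=> x _; rewrite lee_fin powR_ge0.
- exact: mabs.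
- exact: mabs.
- by move=> x _; rewrite lee_fin ge0_ler_powR ?nnegrE.
Qed.

(** Dominated convergence applied to the squares [(g_ n - g) ^+ 2], which lie below [G ^+ 2]. *)
Lemma L2norm_cvg_dominated (g_ : nat -> T -> R) (g G : T -> R)
    (g_L : forall n, g_ n \in Lfun mu 2%:E) (gL : g \in Lfun mu 2%:E) :
  G \in Lfun mu 2%:E -> (forall n t, `|g_ n t - g t| <= G t) ->
  (\forall t \ae mu, g_ n t @[n --> \oo] --> g t) ->
  L2norm (L2_of gL - L2_of (g_L n)) @[n --> \oo] --> 0.
Proof.
move=> GL g_G g_g.
have mg_ n := Lfun2_measurable (g_L n); have mg := Lfun2_measurable gL.
have normE n : L2norm (L2_of gL - L2_of (g_L n)) =
    Num.sqrt (\int[mu]_t ((g_ n t - g t) ^+ 2)).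
  congr Num.sqrt; apply: ae_eq_Rintegral.
  - by apply: measurable_funM; exact: L2_measurable.
  - by apply: measurable_funX; exact: measurable_funB.
  have h1 := L2_addE (L2_of gL) (- L2_of (g_L n)).
  have h2 := L2_scaleE (-1) (L2_of (g_L n)); rewrite scaleN1r in h2.
  apply: filterS2 (filterI h1 h2) (filterI (L2_ofP gL) (L2_ofP (g_L n))).
  by move=> t [-> ->] [-> ->]; ring.
rewrite (_ : (fun n => _) = fun n => Num.sqrt (\int[mu]_t ((g_ n t - g t) ^+ 2))); last first.
  by apply/funext.
have sq0 : \int[mu]_t ((g_ n t - g t) ^+ 2) @[n --> \oo] --> (0 : R).
  have <- : \int[mu]_t (cst 0 t) = 0 :> R by rewrite Rintegral_cst// mul0r.
  apply: (cvg_dominated_Rintegral (G := fun t => G t ^+ 2)) => //.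
  - by move=> n; apply: measurable_funX; exact: measurable_funB.
  - apply: filterS g_g => t gt.
    have h : (g_ n t - g t) @[n --> \oo] --> (0 : R).
      by rewrite -[X in _ --> X](subrr (g t)); apply: cvgB gt _; exact: cvg_cst.
    by rewrite -[X in _ --> X](mulr0 (0 : R)); exact: (cvgM h h).
  - exact: Lfun2_integrable_sqr.
  - move=> n t; rewrite normrX lerXn2r// ?nnegrE//.
    exact: le_trans (g_G n t).
rewrite -[X in _ --> X]sqrtr0.
by apply: continuous_cvg sq0; exact: sqrt_continuous.
Qed.

Lemma L2_of_ext (g h : T -> R) (gL : g \in Lfun mu 2%:E) (hL : h \in Lfun mu 2%:E) :
  g = h -> L2_of gL = L2_of hL.
Proof. by move=> gh; subst h; congr L2_of; exact: eq_irrelevance. Qed.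

Lemma L2_of_coe (f : LspaceType2 mu) : L2_of (L2_Lfun f) = f.
Proof. exact: L2_ae_inj (L2_ofE _). Qed.

End Lfun2_domination.

(** * Closed subspaces seen as sets of functions *)

Section closed_subspaces_of_functions.
Context {d : measure_display} {T : measurableType d} {R : realType}.
Variable P : probability T R.
Variables (S : set (LspaceType2 P)) (cS : closed_subspace S).

Lemma Lfun2_bounded (g : T -> R) M : measurable_fun setT g ->
  (forall t, `|g t| <= M) -> g \in Lfun P 2%:E.
Proof.
move=> mg gM; apply: Lfun2_le (Lfun_cst P M 2) _ => // t.
exact: le_trans (gM t) (ler_norm M).
Qed.

Lemma bounded_integrable (g : T -> R) M : measurable_fun setT g ->
  (forall t, `|g t| <= M) -> P.-integrable setT (EFin \o g).
Proof.
move=> mg gM; apply/Lfun1_integrable; apply: Lfun_subset12.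
  exact: fin_num_measure.
exact: Lfun2_bounded gM.
Qed.

(** Membership in [S] for functions in place of classes, so that pointwise algebra applies; the
    proof of square integrability is packed existentially. *)
Definition in_subspace (g : T -> R) :=
  exists gL : g \in Lfun P 2%:E, S (L2_of gL).

Lemma in_subspaceD g h :
  in_subspace g -> in_subspace h -> in_subspace (fun t => g t + h t).
Proof.
move=> [gL Sg] [hL Sh].
have ghL : (fun t => g t + h t) \in Lfun P 2%:E.
  have := (Lfun_submod_closed P (lee1n 2)).2 1 g h gL hL.
  by rewrite scale1r.
exists ghL; rewrite [X in S X](_ : _ = L2_of gL + L2_of hL); first exact: (closed_subspaceD cS).
apply: L2_ae_inj.
apply: filterS2 (L2_addE (L2_of gL) (L2_of hL))
  (filterI (L2_ofP ghL) (filterI (L2_ofP gL) (L2_ofP hL))).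
by move=> t + [+ [+ +]] _ => -> -> -> ->.
Qed.

Lemma in_subspaceZ a g : in_subspace g -> in_subspace (fun t => a * g t).
Proof.
move=> [gL Sg].
have agL : (fun t => a * g t) \in Lfun P 2%:E.
  have L := Lfun_submod_closed P (lee1n 2).
  by have := L.2 a g 0 gL L.1; rewrite addr0.
exists agL; rewrite [X in S X](_ : _ = a *: L2_of gL); first exact: (closed_subspaceZ cS).
apply: L2_ae_inj.
apply: filterS2 (L2_scaleE a (L2_of gL)) (filterI (L2_ofP agL) (L2_ofP gL)).
by move=> t + [+ +] _ => -> -> ->.
Qed.

(** [g] provides the zero function, as [0 * g], for the empty sum. *)
Lemma in_subspace_sum g (h : nat -> T -> R) n : in_subspace g ->
  (forall k, in_subspace (h k)) -> in_subspace (fun t => \sum_(0 <= k < n) h k t).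
Proof.
move=> gS hS; elim: n => [|n IH].
  rewrite (_ : (fun t => _) = (fun t => 0 * g t)); first exact: in_subspaceZ.
  by apply/funext => t; rewrite big_nil mul0r.
rewrite (_ : (fun t => _) = (fun t => \sum_(0 <= k < n) h k t + h n t)).
  exact: in_subspaceD.
by apply/funext => t; rewrite big_nat_recr.
Qed.

Lemma in_subspace_cvg (g_ : nat -> T -> R) (g G : T -> R) :
  (forall n, in_subspace (g_ n)) -> g \in Lfun P 2%:E -> G \in Lfun P 2%:E ->
  (forall n t, `|g_ n t - g t| <= G t) ->
  (\forall t \ae P, g_ n t @[n --> \oo] --> g t) -> in_subspace g.
Proof.
move=> g_S gL GL g_G g_g; exists gL; apply: (closed_subspace_cvg cS) => eps eps0.
have g_L n : g_ n \in Lfun P 2%:E by have [] := g_S n.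
have /cvgr0_norm_lt/(_ _ eps0)[N _ /(_ N (leqnn N))] :=
  L2norm_cvg_dominated g_L gL GL g_G g_g.
rewrite /= (ger0_norm (L2norm_ge0 _)) => gN.
exists (L2_of (g_L N)) => //; have [gL' Sg] := g_S N.
by rewrite (L2_of_ext (g_L N) gL' erefl).
Qed.

End closed_subspaces_of_functions.

(** * Totality of the weighted monomials *)

Section step_polynomials.
Context {R : realType}.
Implicit Types c x : R.

(** Each of the [n] terms of [(1 - x) (1 + ... + x^(n-1)) = 1 - x^n] is at least [(1 - x) x^n]; the
    proof is by induction. *)
Let natmul_exprn_le x n : 0 <= x -> x <= 1 -> n%:R * x ^+ n * (1 - x) <= 1 - x ^+ n.
Proof.
move=> x0 x1; elim: n => [|n IH]; first by rewrite expr0 !mul0r subrr.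
have xn0 : 0 <= x ^+ n by rewrite exprn_ge0.
have xn1 : x ^+ n <= 1 by rewrite exprn_ile1.
rewrite exprS -natr1.
have h1 : x * (n%:R * x ^+ n * (1 - x)) <= x * (1 - x ^+ n) by rewrite ler_wpM2l.
have h2 : x * x ^+ n * (1 - x) <= 1 - x.
  by rewrite ler_piMl ?subr_ge0// mulr_ile1.
by nra.
Qed.

Lemma cvg_natmul_exprn x : 0 <= x -> x < 1 -> n%:R * x ^+ n @[n --> \oo] --> (0 : R).
Proof.
(* Splitting [x^n] as [s^n s^n], one factor absorbs [n]: [n s^n <= 1 / (1 - s)], and the other tends
   to 0. *)
move=> x0 x1; set s := Num.sqrt x.
have s0 : 0 <= s by exact: sqrtr_ge0.
have s1 : s < 1 by rewrite /s -sqrtr1 ltr_sqrt.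
have cs : (1 - s)^-1 * s ^+ n @[n --> \oo] --> (0 : R).
  rewrite -[X in _ --> X](mulr0 (1 - s)^-1); apply: cvgM; first exact: cvg_cst.
  by apply: cvg_expr; rewrite ger0_norm.
apply: squeeze_cvgr (cvg_cst 0) cs; apply: nearW => n.
rewrite mulr_ge0 ?exprn_ge0//= -(sqr_sqrtr x0) -/s -exprM mul2n -addnn exprD mulrA.
rewrite ler_wpM2r ?exprn_ge0// -[leRHS]mul1r ler_pdivlMr ?subr_gt0//.
apply: le_trans (natmul_exprn_le n s0 (ltW s1)) _.
by rewrite gerBl exprn_ge0.
Qed.

(** Bernoulli's inequality. *)
Lemma exprn_1B_ge x m : 0 <= x -> x <= 1 -> 1 - m%:R * x <= (1 - x) ^+ m.
Proof.
move=> x0 x1; elim: m => [|m IH]; first by rewrite mul0r subr0 expr0.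
rewrite exprS -natr1.
have h1 : (1 - x) * (1 - m%:R * x) <= (1 - x) * (1 - x) ^+ m.
  by rewrite ler_wpM2l// subr_ge0.
have : 0 <= m%:R * x ^+ 2 by rewrite mulr_ge0// sqr_ge0.
by nra.
Qed.

(* The exponent grows like [n / c ^ n], so that [step_exponent c n * x ^ n]
   tends to [0] for [x < c] and to infinity for [x >= c]. *)
Definition step_exponent c n := (Num.truncn (n%:R / c ^+ n)).+1.

(** Being polynomial in [x], it sends elements of an algebra of functions to elements of the same
    algebra. *)
Definition step_poly c n x := 1 - (1 - x ^+ n) ^+ step_exponent c n.

Lemma step_poly_itv c n x : 0 <= x -> x <= 1 -> 0 <= step_poly c n x <= 1.
Proof.
move=> x0 x1; have xn1 : x ^+ n <= 1 by rewrite exprn_ile1.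
have xn0 : 0 <= x ^+ n by rewrite exprn_ge0.
by rewrite subr_ge0 gerBl exprn_ge0 ?subr_ge0// exprn_ile1 ?subr_ge0// gerBl.
Qed.

Lemma cvg_step_poly c x : 0 < c -> c <= 1 -> 0 <= x -> x <= 1 ->
  step_poly c n x @[n --> \oo] --> ((c <= x)%R%:R : R).
Proof.
move=> c0 c1 x0 x1.
have xn1 n : x ^+ n <= 1 by rewrite exprn_ile1.
have xn0 n : 0 <= x ^+ n by rewrite exprn_ge0.
have cn0 n : 0 < c ^+ n by rewrite exprn_gt0.
have M_ge n : n%:R / c ^+ n <= (step_exponent c n)%:R.
  by rewrite ltW// truncnS_gt.
have M_le n : (step_exponent c n)%:R <= n%:R / c ^+ n + 1.
  by rewrite -natr1 lerD2r truncn_le divr_ge0// ltW.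
suff h : (1 - x ^+ n) ^+ step_exponent c n @[n --> \oo] --> ((x < c)%R%:R : R).
  have -> : (c <= x)%R%:R = 1 - (x < c)%R%:R :> R.
    by case: leP; rewrite ?subr0 ?subrr.
  by apply: cvgB h; exact: cvg_cst.
case: (leP c x) => [cx|xc] /=.
  (* For [c <= x], with [M] the exponent: [(1 - x^n)^M <= exp (- M x^n) <= exp (- n)], because
     [M x^n >= n (x / c)^n >= n]. *)
  apply: squeeze_cvgr (cvg_cst 0) (@cvgn_expR R); apply: nearW => n.
  rewrite exprn_ge0 ?subr_ge0//=.
  apply: (@le_trans _ _ (expR (- (x ^+ n)) ^+ step_exponent c n)).
    by rewrite lerXn2r ?nnegrE ?subr_ge0 ?expR_ge0//; exact: expR_ge1Dx.
  rewrite -expRM_natl ler_expR mulrN lerN2.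
  apply: (@le_trans _ _ (n%:R / c ^+ n * x ^+ n)); last by rewrite ler_wpM2r.
  rewrite mulrAC ler_pdivlMr// ler_wpM2l// lerXn2r ?nnegrE// ltW//.
(* For [x < c] this is Bernoulli's lower bound; the extra [x ^+ n] pays for rounding the exponent
   up. *)
have h0 : 1 - (n%:R * (x / c) ^+ n + x ^+ n) @[n --> \oo] --> (1 : R).
  rewrite -[X in _ --> X](subr0 1); apply: cvgB; first exact: cvg_cst.
  rewrite -[X in _ --> X](addr0 0); apply: cvgD.
    by apply: cvg_natmul_exprn; [rewrite divr_ge0// ltW|rewrite ltr_pdivrMr// mul1r].
  by apply: cvg_expr; rewrite ger0_norm// (lt_le_trans xc).
apply: (@squeeze_cvgr _ _ _ _ _ _ _ _ (1 : R) h0 (cvg_cst (1 : R))); apply: nearW => n.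
rewrite exprn_ile1 ?subr_ge0 ?gerBl// andbT.
apply: le_trans (exprn_1B_ge _ (xn0 n) (xn1 n)); rewrite lerD2l lerN2.
apply: (@le_trans _ _ ((n%:R / c ^+ n + 1) * x ^+ n)); first by rewrite ler_wpM2r.
by rewrite mulrDl mul1r expr_div_n mulrAC mulrA.
Qed.

End step_polynomials.

(** * Weighted monomials and their growth *)

Section weighted_monomials.
Context {R : realType} {d : nat}.
Local Notation E := (d.-tuple (measurableTypeR R)).
Implicit Types (t : E) (w : seq 'I_d).

Definition mon w t : R := \prod_(i <- w) tnth t i.

(** The function phi_w without its constant factor [1 / sqrt (n!)]. *)
Definition wmon w t : R := mon w t * expR (- (dotp t t / 2)).

Lemma measurable_coord (i : 'I_d) : measurable_fun setT (fun t => tnth t i : R).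
Proof. exact: measurable_tnth. Qed.

Lemma measurable_dotp : measurable_fun setT (fun t => dotp t t).
Proof. by apply: measurable_sum => i; apply: measurable_funM; exact: measurable_coord. Qed.

Lemma measurable_wmon w : measurable_fun setT (wmon w).
Proof.
apply: measurable_funM.
  by apply: measurable_prod => i _; exact: measurable_coord.
apply: measurableT_comp => //; apply: measurableT_comp => //.
by apply: measurable_funM => //; exact: measurable_dotp.
Qed.

Lemma sqr_coord_le t i : (tnth t i : R) ^+ 2 <= dotp t t.
Proof.
rewrite /dotp (bigD1 i)//= -expr2 lerDl sumr_ge0// => j _.
by rewrite -expr2 sqr_ge0.
Qed.

Lemma dotp_ge0 t : 0 <= dotp t t.
Proof. by apply: sumr_ge0 => i _; rewrite -expr2 sqr_ge0. Qed.

(** Each coordinate obeys [|x| <= 1 + x^2 <= (1 + e |t|^2) / e <= exp (e |t|^2) / e]. *)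
Lemma norm_mon_le w t (e : R) : 0 < e -> e <= 1 ->
  `|mon w t| <= (e^-1 * expR (e * dotp t t)) ^+ size w.
Proof.
move=> e0 e1; have ei0 : 0 <= e^-1 by rewrite invr_ge0 ltW.
elim: w => [|i w IH]; first by rewrite /mon big_nil normr1 expr0.
rewrite /mon big_cons normrM exprS ler_pM//.
set x : R := tnth t i.
have ex : 1 + e * dotp t t <= expR (e * dotp t t) by exact: expR_ge1Dx.
apply: (@le_trans _ _ (1 + x ^+ 2)).
  rewrite -(real_normK (num_real x)); have := sqr_ge0 (`|x| - 1).
  have := normr_ge0 x; nra.
apply: (@le_trans _ _ (e^-1 * (1 + e * dotp t t))); last by rewrite ler_wpM2l.
rewrite mulrDr mulr1 mulKf ?gt_eqF// lerD ?sqr_coord_le//.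
by rewrite -invr1 lef_pV2 ?posrE.
Qed.

(** Spends only half of the Gaussian weight of [wmon]; the remaining [expR (- (dotp t t / 4))]
    absorbs the power series of [gauss_bump]. *)
Lemma mon_bound w : exists C, forall t, `|mon w t| <= C * expR (dotp t t / 4).
Proof.
have [->|w0] := eqVneq w [::].
  exists 1 => t; rewrite /mon big_nil normr1 mul1r -expR0 ler_expR.
  by rewrite divr_ge0// dotp_ge0.
have n0 : 0 < (size w)%:R :> R by rewrite ltr0n lt0n size_eq0.
(* Chosen so that [size w] factors [expR (e * dotp t t)] multiply to [expR (dotp t t / 4)]. *)
pose e : R := (4 * (size w)%:R)^-1.
have e0 : 0 < e by rewrite invr_gt0 mulr_gt0.
have e1 : e <= 1.
  rewrite -invr1 lef_pV2 ?posrE ?mulr_gt0// (@le_trans _ _ 4) ?ler1n//.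
  by rewrite ler_peMr// ler1n lt0n size_eq0.
exists (e^-1 ^+ size w) => t; apply: le_trans (norm_mon_le w t e0 e1) _.
rewrite exprMn -expRM_natl le_eqVlt; apply/orP; left; apply/eqP.
congr (_ * expR _); rewrite /e invfM mulrA; field.
by rewrite gt_eqF.
Qed.

Lemma norm_wmon_le w C : (forall t, `|mon w t| <= C * expR (dotp t t / 4)) ->
  forall t, `|wmon w t| <= C * expR (- (dotp t t / 4)).
Proof.
move=> wC t; rewrite /wmon normrM (ger0_norm (expR_ge0 _)).
have -> : - (dotp t t / 4) = dotp t t / 4 - dotp t t / 2 by lra.
by rewrite expRD mulrA ler_wpM2r ?expR_ge0.
Qed.

Lemma wmon_cons i w t : wmon (i :: w) t = tnth t i * wmon w t.
Proof. by rewrite /wmon /mon big_cons mulrA. Qed.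

Lemma wmon_bounded w : exists C, forall t, `|wmon w t| <= C.
Proof.
have [C wC] := mon_bound w; exists C => t.
apply: le_trans (norm_wmon_le wC t) _.
have C0 : 0 <= C.
  have := le_trans (normr_ge0 _) (wC t).
  by rewrite pmulr_lge0 ?expR_gt0.
rewrite ler_piMr// -[leRHS]expR0 ler_expR oppr_le0 divr_ge0 ?dotp_ge0 //.
Qed.

End weighted_monomials.

Import HBSimple HBNNSimple.

(** * A closed subspace containing the long weighted monomials is everything *)

Section density.
Context {R : realType} {d : nat}.
Local Notation E := (d.-tuple (measurableTypeR R)).
Variable P : probability E R.
Variables (S : set (LspaceType2 P)) (cS : closed_subspace S).
Hypothesis S_wmon : forall w, (2 < size w)%N -> in_subspace S (wmon w).
Implicit Types (t : E) (w : seq 'I_d) (g u : E -> R).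

(** Quantifying over all long words lets a coordinate factor be absorbed into [w], as in
    [V_coord_pow]. *)
Let V g := [/\ measurable_fun setT g, exists M : R, forall t, `|g t| <= M &
  forall w, (2 < size w)%N -> in_subspace S (fun t => wmon w t * g t)].

Let VD g u : V g -> V u -> V (fun t => g t + u t).
Proof.
move=> [mg [M gM] gV] [mu [N uN] uV]; split; first exact: measurable_funD.
  by exists (M + N) => t; rewrite (le_trans (ler_normD _ _))// lerD.
move=> w w2; rewrite (_ : (fun t => _) = fun t => wmon w t * g t + wmon w t * u t).
  by apply: in_subspaceD => //; [exact: gV|exact: uV].
by apply/funext => t; rewrite mulrDr.
Qed.

Let VZ a g : V g -> V (fun t => a * g t).
Proof.
move=> [mg [M gM] gV]; split; first exact: measurable_funM.
  by exists (`|a| * M) => t; rewrite normrM ler_wpM2l.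
move=> w w2; rewrite (_ : (fun t => _) = fun t => a * (wmon w t * g t)).
  by apply: in_subspaceZ => //; exact: gV.
by apply/funext => t; rewrite mulrCA.
Qed.

Let V_cvg (g_ : nat -> E -> R) g (M : R) : (forall n, V (g_ n)) ->
  (forall n t, `|g_ n t| <= M) -> (forall t, `|g t| <= M) ->
  (forall t, g_ n t @[n --> \oo] --> g t) -> V g.
Proof.
move=> Vg g_M gM g_g.
have mg : measurable_fun setT g.
  apply: (@measurable_fun_cvg _ _ _ _ g_) => [n|t _]; first by have [] := Vg n.
  exact: g_g.
split; [exact: mg|by exists M|].
move=> w w2; have [C wC] := @wmon_bounded R d w.
have wb g' : (forall t, `|g' t| <= M) -> forall t, `|wmon w t * g' t| <= C * M.
  by move=> g'M t; rewrite normrM ler_pM.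
apply: (in_subspace_cvg cS (g_ := fun n t => wmon w t * g_ n t)
    (G := cst (C * M + C * M))).
- by move=> n; have [_ _] := Vg n; exact.
- by apply: Lfun2_bounded (wb _ gM); apply: measurable_funM => //; exact: measurable_wmon.
- exact: Lfun_cst.
- move=> n t; apply: le_trans (ler_normB _ _) _; apply: lerD; exact: wb.
- apply: aeW => t; apply: cvgM; [exact: cvg_cst|exact: g_g].
Qed.

Let V1 : V (cst 1).
Proof.
split; [exact: measurable_cst|by exists 1 => t; rewrite normr1|move=> w w2].
by under eq_fun do rewrite mulr1; exact: S_wmon.
Qed.

(** The multipliers of [V] are closed under products by mere composition, which the definition of
    [V] does not give directly. *)
Let mult u := forall g, V g -> V (fun t => g t * u t).

Let mult_V u : mult u -> V u.
Proof. by move=> /(_ _ V1); under eq_fun do rewrite mul1r. Qed.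

Let multD u v : mult u -> mult v -> mult (fun t => u t + v t).
Proof.
by move=> mu mv g Vg; under eq_fun do rewrite mulrDr; exact: VD (mu _ Vg) (mv _ Vg).
Qed.

Let multZ a u : mult u -> mult (fun t => a * u t).
Proof. by move=> mu g Vg; under eq_fun do rewrite mulrCA; exact: VZ (mu _ Vg). Qed.

Let multM u v : mult u -> mult v -> mult (fun t => u t * v t).
Proof. by move=> mu mv g Vg; under eq_fun do rewrite mulrA; exact: mv (mu _ Vg). Qed.

Let mult1 : mult (cst 1).
Proof. by move=> g; under [in X in _ -> X]eq_fun do rewrite mulr1. Qed.

Let mult1B u : mult u -> mult (fun t => 1 - u t).
Proof.
move=> mu; under eq_fun do rewrite -mulN1r.
exact: multD mult1 (multZ _ mu).
Qed.

Let multX u n : mult u -> mult (fun t => u t ^+ n).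
Proof.
move=> mu; elim: n => [|n IH]; first exact: mult1.
by under eq_fun do rewrite exprS; exact: multM.
Qed.

Let mult_cvg (u_ : nat -> E -> R) u (M : R) : (forall n, mult (u_ n)) ->
  (forall n t, `|u_ n t| <= M) -> (forall t, `|u t| <= M) ->
  (forall t, u_ n t @[n --> \oo] --> u t) -> mult u.
Proof.
move=> mu u_M uM u_u g Vg; have [_ [N gN] _] := Vg.
apply: (V_cvg (g_ := fun n t => g t * u_ n t) (M := N * M)).
- by move=> n; exact: mu.
- by move=> n t; rewrite normrM ler_pM.
- by move=> t; rewrite normrM ler_pM.
- by move=> t; apply: cvgM; [exact: cvg_cst|exact: u_u].
Qed.

(** Multiplying [wmon w] by the coordinate [i] lengthens the word to [i :: w], which is still
    admissible. *)
Let V_coord_pow g i y k : V g -> forall w, (2 < size w)%N ->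
  in_subspace S (fun t => wmon w t * g t * ((tnth t i : R) - y) ^+ k).
Proof.
move=> [_ _ gV]; elim: k => [|k IH] w w2.
  by under eq_fun do rewrite expr0 mulr1; exact: gV.
rewrite (_ : (fun t => _) = fun t =>
    wmon (i :: w) t * g t * ((tnth t i : R) - y) ^+ k +
    (- y) * (wmon w t * g t * ((tnth t i : R) - y) ^+ k)).
  apply: in_subspaceD => //; first by apply: IH; rewrite ltnS ltnW.
  by apply: in_subspaceZ => //; exact: IH.
by apply/funext => t; rewrite wmon_cons exprS; ring.
Qed.

(** The divisor 8 is used in [(x - y)^2 / 8 <= (x^2 + y^2) / 4]: the exponential of the right side
    is compensated by the decay of [wmon]. *)
Let gauss_bump i y t : R := expR (- (((tnth t i : R) - y) ^+ 2 / 8)).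

(** Expand the bump in its power series: every term times [wmon w * g] is in [S] by [V_coord_pow],
    and the partial sums are bounded uniformly. *)
Let mult_gauss_bump i y : mult (gauss_bump i y).
Proof.
move=> g Vg; have [mg [M gM] gV] := Vg.
have gb_le1 t : `|gauss_bump i y t| <= 1.
  rewrite ger0_norm ?expR_ge0// -expR0 ler_expR oppr_le0 divr_ge0 ?sqr_ge0 //.
have mgb : measurable_fun setT (gauss_bump i y).
  apply: measurableT_comp => //; apply: measurableT_comp => //.
  apply: measurable_funM => //; apply: measurable_funX; apply: measurable_funB => //.
  exact: measurable_coord.
have mgg : measurable_fun setT (fun t => g t * gauss_bump i y t).
  exact: measurable_funM.
split => //; first by exists (M * 1) => t; rewrite normrM ler_pM.
move=> w w2; have [C wC] := @mon_bound R d w.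
have C0 : 0 <= C.
  have := le_trans (normr_ge0 _) (wC [tuple 0 | j < d]).
  by rewrite pmulr_lge0 ?expR_gt0.
have M0 : 0 <= M by apply: le_trans (gM [tuple 0 | j < d]).
pose z t : R := - (((tnth t i : R) - y) ^+ 2 / 8).
have gb_le t : `|gauss_bump i y t| <= expR `|z t|.
  by apply: le_trans (gb_le1 t) _; rewrite -expR0 ler_expR.
pose g_ n t := \sum_(0 <= k < n) wmon w t * g t * exp_coeff (z t) k.
have g_E n t : g_ n t = wmon w t * g t * \sum_(0 <= k < n) exp_coeff (z t) k.
  by rewrite mulr_sumr.
have z_le t : expR `|z t| <= expR (y ^+ 2 / 4) * expR (dotp t t / 4).
  rewrite -expRD ler_expR normrN ger0_norm; last by rewrite divr_ge0// sqr_ge0.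
  have := sqr_coord_le t i; have := sqr_ge0 ((tnth t i : R) + y); nra.
have wg_le t : `|wmon w t * g t| * expR `|z t| <= C * M * expR (y ^+ 2 / 4).
  rewrite normrM.
  apply: (@le_trans _ _ (C * expR (- (dotp t t / 4)) * M *
      (expR (y ^+ 2 / 4) * expR (dotp t t / 4)))).
    apply: ler_pM; [exact: mulr_ge0|exact: expR_ge0| |exact: z_le].
    by apply: ler_pM => //; exact: norm_wmon_le.
  rewrite expRN le_eqVlt; apply/orP; left; apply/eqP.
  by field; rewrite gt_eqF// expR_gt0.
(* The factor 2 covers a partial sum and the limit, each bounded through [wg_le]. *)
apply: (in_subspace_cvg cS (g_ := g_) (G := cst (C * M * expR (y ^+ 2 / 4) * 2))).
- move=> n; apply: (in_subspace_sum cS n (S_wmon w2)) => k.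
  rewrite (_ : (fun t => _) = (fun t => ((-8^-1) ^+ k / k`!%:R) *
      (wmon w t * g t * ((tnth t i : R) - y) ^+ (2 * k)))).
    by apply: in_subspaceZ => //; exact: V_coord_pow.
  apply/funext => t; rewrite /exp_coeff/= /z -mulrN exprMn -exprM.
  by rewrite [RHS]mulrC -!mulrA; congr (_ * (_ * (_ * _))); rewrite mulrC.
- apply: Lfun2_bounded; first by apply: measurable_funM => //; exact: measurable_wmon.
  by move=> t; rewrite mulrA normrM; apply: le_trans (wg_le t); rewrite ler_wpM2l.
- exact: Lfun_cst.
- move=> n t; rewrite g_E mulrA -mulrBr normrM mulr_natr mulr2n.
  apply: le_trans (lerD (wg_le t) (wg_le t)); rewrite -mulrDr ler_wpM2l//.
  apply: le_trans (ler_normB _ _) _.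
  by apply: lerD; [exact: norm_sum_exp_coeff_le|exact: gb_le].
- apply: aeW => t; under eq_cvg do rewrite g_E.
  rewrite mulrA; apply: cvgM; [exact: cvg_cst|exact: cvg_sum_exp_coeff].
Qed.

Let mult_ge u (c : R) : mult u -> (forall t, 0 <= u t <= 1) -> 0 < c -> c <= 1 ->
  mult (\1_[set t | c <= u t]).
Proof.
move=> mu u01 c0 c1.
apply: (mult_cvg (u_ := fun n t => step_poly c n (u t)) (M := 1)).
- by move=> n; apply: mult1B; apply: multX; apply: mult1B; exact: multX.
- move=> n t; have /andP[u0 u1] := u01 t.
  by have /andP[p0 p1] := step_poly_itv c n u0 u1; rewrite ger0_norm.
- by move=> t; rewrite indicE; case: (_ \in _); rewrite ?normr1 ?normr0.
- move=> t; have /andP[u0 u1] := u01 t.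
  rewrite indicE (_ : (t \in _) = (c <= u t)); first exact: cvg_step_poly.
  by apply/idP/idP => [/set_mem//|ct]; apply/mem_set.
Qed.

Let multS : set (set E) := [set B | mult \1_B].

(** A closed slab is a superlevel set of a bump; [|r|] keeps the half-width nonnegative for every
    [r]. *)
Let multS_closed_itv i (y r : R) : multS ((fun t => tnth t i : R) @^-1` `[y - `|r|, y + `|r|]).
Proof.
rewrite /multS/= (_ : _ @^-1` _ = [set t | expR (- (r ^+ 2 / 8)) <= gauss_bump i y t]).
  apply: mult_ge.
  - exact: mult_gauss_bump.
  - move=> t; rewrite expR_ge0/= -expR0 ler_expR oppr_le0 divr_ge0 ?sqr_ge0//.
  - exact: expR_gt0.
  - by rewrite -expR0 ler_expR oppr_le0 divr_ge0 ?sqr_ge0.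
have key t : (expR (- (r ^+ 2 / 8)) <= gauss_bump i y t) = (`|(tnth t i : R) - y| <= `|r|).
  rewrite /gauss_bump ler_expR lerN2 ler_pM2r// -(real_normK (num_real r)).
  by rewrite -(real_normK (num_real (_ - y))) ler_sqr ?nnegrE.
by apply/seteqP; split => t /=; rewrite in_itv/= key ler_norml => /andP[h1 h2];
  apply/andP; split; lra.
Qed.

Let sigma_algebra_multS : sigma_algebra setT multS.
Proof.
split => [|B mB|F mF]; rewrite /multS/=.
- have -> : \1_set0 = (fun t : E => 0 * cst 1 t) :> (E -> R).
    by apply/funext => t; rewrite indic0 mul0r.
  exact: (multZ 0 mult1).
- rewrite (_ : \1_ _ = fun t => 1 - \1_B t :> R); first exact: mult1B.
  by apply/funext => t; rewrite !indicE setTD in_setC; case: (t \in B); rewrite ?subrr ?subr0.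
(* These are the indicators of the finite unions, eventually constant at each point. *)
- apply: (mult_cvg (u_ := fun n t => 1 - \prod_(i < n) (1 - \1_(F i) t)) (M := 1)).
  + move=> n; apply: mult1B; elim: n => [|n IH].
      by under eq_fun do rewrite big_ord0; exact: mult1.
    by under eq_fun do rewrite big_ord_recr/=; exact: (multM IH (mult1B (mF n))).
  + move=> n t; have : (0 : R) <= \prod_(i < n) (1 - (\1_(F i) t : R)) <= 1.
      apply/andP; split.
        by apply: prodr_ge0 => i _; rewrite indicE; case: (_ \in _); rewrite ?subrr ?subr0.
      by apply: prodr_ile1 => i _; rewrite indicE; case: (_ \in _); rewrite ?subrr ?subr0 ?lexx ?ler01.
    by move=> /andP[p0 p1]; rewrite ger0_norm ?subr_ge0// gerBl.
  + by move=> t; rewrite indicE; case: (_ \in _); rewrite ?normr1 ?normr0.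
  + move=> t; apply: cvg_near_cst; rewrite indicE.
    have [/set_mem[k _ Fk]|tF] := boolP (t \in _).
      exists k.+1 => // n /= kn; rewrite (bigD1 (Ordinal kn))//= indicE mem_set//.
      by rewrite subrr mul0r subr0.
    apply: nearW => n; rewrite big1 ?subrr// => i _; rewrite indicE memNset ?subr0//.
    by move=> Fi; move/negP: tF; apply; apply/mem_set; exists i.
Qed.

Let multS_coord i (A : set (measurableTypeR R)) : measurable A ->
  multS ((fun t => tnth t i) @^-1` A).
Proof.
have [s0 sC sU] := sigma_algebra_multS.
move=> mA; have {mA} : (<<s @RGenCInfty.G R >>) A.
  have : (@ocitv R).-sigma.-measurable A by exact: mA.
  by rewrite RGenCInfty.measurableE.
move: A; apply: smallest_sub => [|_ [x ->]] /=.
  split => [|A|F mF] /=.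
  - by rewrite preimage_set0.
  - by move=> /sC; rewrite !setTD.
  - by rewrite preimage_bigcup; exact: sU.
(* The generating ray [[x, +oo[] is the union of the intervals of centre [x + n] and radius [n],
   that is [[x, x + 2 n]]. *)
rewrite (_ : (_ @^-1` _) =
    \bigcup_n ((fun t => tnth t i : R) @^-1` `[(x + n%:R) - `|n%:R|, (x + n%:R) + `|n%:R|])).
  by apply: sU => n; exact: multS_closed_itv.
apply/seteqP; split => t /=.
  rewrite in_itv/= andbT => xt.
  have t0 : 0 <= (tnth t i : R) - x by rewrite subr_ge0.
  exists (Num.truncn ((tnth t i : R) - x)).+1 => //=.
  rewrite in_itv/= ger0_norm// addrK xt/=.
  have := truncnS_gt ((tnth t i : R) - x).
  have : 0 <= (Num.truncn ((tnth t i : R) - x)).+1%:R :> R by [].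
  by lra.
by move=> [n _] /=; rewrite !in_itv/= ger0_norm// addrK andbT => /andP[].
Qed.

Let multS_measurable (B : set E) : measurable B -> multS B.
Proof.
move: B; apply: smallest_sub => //.
(* The generators on tuples are a finite union, over the coordinates, of systems of preimages. *)
elim/big_ind : _ => [|F G FS GS|i _]; first by [].
- by move=> B [/FS|/GS].
- by move=> _ [A mA <-]; rewrite setTI; exact: multS_coord.
Qed.

Let V_nnsfun (h : {nnsfun E >-> R}) : V h.
Proof.
have hE t : h t = \sum_(y <- finmap.enum_fset (fset_set (range h)))
    (y * \1_(h @^-1` [set y]) t) by rewrite fimfunE fsbig_finite.
rewrite (funext hE : (h : E -> R) = _).
elim: (finmap.enum_fset _) => [|y s IH].
  by under eq_fun do rewrite big_nil -(mul0r 1); exact: VZ V1.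
under eq_fun do rewrite big_cons; apply: VD => //; apply: VZ; apply: mult_V.
exact: multS_measurable.
Qed.

(** Simple functions [h n] increase to [f / wmon w], so [wmon w * h n] lies in [S], stays between 0
    and [f], and tends to [f] off the null set where the coordinate [i] vanishes. *)
Let in_subspace_ge0 (i : 'I_d) (f : E -> R) : P [set t | tnth t i = 0] = 0%E ->
  f \in Lfun P 2%:E -> (forall t, 0 <= f t) -> in_subspace S f.
Proof.
move=> Pi0 fL f0; have mf := Lfun2_measurable fL.
(* Length 4 exceeds 2, and the even power makes the weight nonnegative. *)
pose w := [:: i; i; i; i].
have wE t : wmon w t = (tnth t i) ^+ 4 * expR (- (dotp t t / 2)) :> R.
  by rewrite /wmon /mon !big_cons big_nil mulr1.
have w0 t : 0 <= wmon w t :> R by rewrite wE mulr_ge0 ?expR_ge0// exprn_even_ge0.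
have mq : measurable_fun setT (fun t => (f t / wmon w t)%:E).
  apply/measurable_EFinP; apply: measurable_funM => //.
  under eq_fun do rewrite -(powR_inv1 (w0 _)).
  apply: (@measurableT_comp _ _ _ _ _ _ (@powR R ^~ (-1))); first exact: measurable_powR.
  exact: measurable_wmon.
pose h n := nnsfun_approx measurableT mq n.
have q0 t : setT t -> (0 <= (f t / wmon w t)%:E)%E by rewrite lee_fin divr_ge0.
have h_cvg t : h n t @[n --> \oo] --> f t / wmon w t.
  by have /fine_cvgP[_] := cvg_nnsfun_approx measurableT mq q0 (I : setT t); exact.
have h_le n t : h n t <= f t / wmon w t.
  have hnd : nondecreasing_seq (fun n => h n t).
    by move=> m k mk; have /lefP/(_ t) := nd_nnsfun_approx measurableT mq mk.
  rewrite -(cvg_lim (@Rhausdorff R) (h_cvg t)).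
  by apply: nondecreasing_cvgn_le => //; apply/cvg_ex; exists (f t / wmon w t); exact: h_cvg.
have wh_le n t : wmon w t * h n t <= f t.
  have [->|w1] := eqVneq (wmon w t : R) 0; first by rewrite mul0r.
  by rewrite mulrC -ler_pdivlMr// lt_neqAle eq_sym w1 w0.
apply: (in_subspace_cvg cS (g_ := fun n t => wmon w t * h n t) (G := f)) => //.
- by move=> n; have [_ _ +] := V_nnsfun (h n); exact.
- move=> n t; rewrite distrC ger0_norm ?subr_ge0// gerBl mulr_ge0//.
- exists [set t | tnth t i = 0]; split => //.
    rewrite -[X in measurable X]setTI.
    exact: (@measurable_coord R d i measurableT _ (measurable_set1 (0 : R))).
  move=> t /= nt; apply: contrapT => t0; apply: nt.
  have w1 : wmon w t != 0 :> R.
    rewrite wE; apply: mulf_neq0; first by apply: expf_neq0; exact/eqP.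
    by rewrite gt_eqF// expR_gt0.
  rewrite -[X in _ --> X](_ : wmon w t * (f t / wmon w t) = f t).
    by apply: cvgM; [exact: cvg_cst|exact: h_cvg].
  by rewrite mulrC divfK.
Qed.

(** Writes [f] as [|f| - (|f| - f)], a difference of nonnegative functions. *)
Lemma closed_subspace_wmon_full (i : 'I_d) : P [set t | tnth t i = 0] = 0%E ->
  forall f, S f.
Proof.
move=> Pi0 f; set F := f : E -> R.
have FL : F \in Lfun P 2%:E := L2_Lfun f.
have mF := Lfun2_measurable FL.
have absL : (fun t => `|F t|) \in Lfun P 2%:E.
  apply: (Lfun2_le _ FL) => [|t]; last by rewrite normr_id.
  exact: (@measurableT_comp _ _ _ _ _ _ (@Num.norm _ R)).
have L := Lfun_submod_closed P (lee1n 2).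
have subL : (fun t => `|F t| - F t) \in Lfun P 2%:E.
  rewrite (_ : (fun t => _) = (-1) *: F + (fun t => `|F t|)); first exact: L.2.
  by apply/funext => t; rewrite scaleN1r addrC.
have : in_subspace S F.
  rewrite (_ : F = fun t => `|F t| + (-1) * (`|F t| - F t)).
    apply: in_subspaceD => //; first exact: (in_subspace_ge0 Pi0).
    apply: in_subspaceZ => //; apply: (in_subspace_ge0 Pi0) => // t.
    by rewrite subr_ge0 ler_norm.
  by apply/funext => t; ring.
by move=> [gL]; rewrite (L2_of_ext gL (L2_Lfun f) erefl) L2_of_coe.
Qed.

End density.

(** * Expansion of the kernel *)

Section Rintegral_sum.
Context {d : measure_display} {T : measurableType d} {R : realType}.
Variables (mu : {measure set T -> \bar R}) (I : Type) (F : I -> T -> R).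
Hypothesis iF : forall i, mu.-integrable setT (EFin \o F i).

Lemma integrable_sumr (r : seq I) :
  mu.-integrable setT (EFin \o (fun x => \sum_(i <- r) F i x)).
Proof.
rewrite (_ : EFin \o _ = (fun x => \sum_(i <- r) (F i x)%:E)%E).
  by apply: (integrable_sum measurableT) => i _; exact: iF.
by apply/funext => x; rewrite /= sumEFin.
Qed.

Lemma Rintegral_sum (r : seq I) :
  \int[mu]_x (\sum_(i <- r) F i x) = \sum_(i <- r) \int[mu]_x F i x.
Proof.
elim: r => [|i r IH].
  rewrite big_nil; under eq_Rintegral do rewrite big_nil.
  by rewrite Rintegral_cst// mul0r.
rewrite big_cons -IH -RintegralD//; last exact: integrable_sumr.
by apply: eq_Rintegral => x _; rewrite big_cons.
Qed.

End Rintegral_sum.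

Section kernel_expansion.
Context {R : realType} {d : nat}.
Local Notation E := (d.-tuple (measurableTypeR R)).
Implicit Types s t : E.

(** The function phi_w, with words given as functions on positions so that distributivity of
    products over sums applies. *)
Definition feature n (w : {ffun 'I_n -> 'I_d}) t : R :=
  (Num.sqrt n`!%:R)^-1 * wmon (codom w) t.

Definition kernel_sum N s t : R :=
  \sum_(3 <= n < N) \sum_(w : {ffun 'I_n -> 'I_d}) feature w s * feature w t.

Lemma mon_codom n (w : {ffun 'I_n -> 'I_d}) t :
  mon (codom w) t = \prod_(i < n) tnth t (w i) :> R.
Proof. by rewrite /mon /codom /image_mem big_map big_enum. Qed.

Lemma dotp_exprn n s t : dotp s t ^+ n =
  \sum_(w : {ffun 'I_n -> 'I_d}) mon (codom w) s * mon (codom w) t.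
Proof.
rewrite -[in LHS](card_ord n) -prodr_const /dotp.
rewrite (bigA_distr_bigA (fun _ j => (tnth s j : R) * tnth t j)) /=.
by apply: eq_bigr => w _; rewrite !mon_codom big_split.
Qed.

Lemma sum_feature n s t :
  \sum_(w : {ffun 'I_n -> 'I_d}) feature w s * feature w t =
  exp_coeff (dotp s t) n * expR (- ((dotp s s + dotp t t) / 2)).
Proof.
rewrite /exp_coeff/= dotp_exprn mulr_suml mulr_suml; apply: eq_bigr => w _.
rewrite /feature /wmon -[in RHS](sqr_sqrtr (ler0n R n`!)) mulrDl opprD expRD.
by rewrite expr2 invfM; ring.
Qed.

Lemma kernel_sumE N s t : kernel_sum N s t =
  (\sum_(3 <= n < N) exp_coeff (dotp s t) n) * expR (- ((dotp s s + dotp t t) / 2)).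
Proof. by rewrite mulr_suml; apply: eq_bigr => n _; exact: sum_feature. Qed.

Lemma norm_dotp_le s t : `|dotp s t| <= (dotp s s + dotp t t) / 2.
Proof.
rewrite -big_split/= mulr_suml; apply: le_trans (ler_norm_sum _ _ _) _.
apply: ler_sum => i _; rewrite ler_norml; set a : R := tnth s i; set b : R := tnth t i.
have := sqr_ge0 (a + b); have := sqr_ge0 (a - b) => h1 h2.
by apply/andP; split; nra.
Qed.

(** The series is at most [exp |s . t|], and [|s . t| <= (|s|^2 + |t|^2) / 2] is exactly what the
    Gaussian weight cancels. *)
Lemma norm_kernel_sum_le N s t : `|kernel_sum N s t| <= 1.
Proof.
rewrite kernel_sumE normrM (ger0_norm (expR_ge0 _)) expRN ler_pdivrMr ?expR_gt0//.
rewrite mul1r; apply: le_trans (norm_sum_exp_coeff_le _ _ _) _.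
by rewrite ler_expR norm_dotp_le.
Qed.

Lemma kernelKE s t : kernelK s t =
  (expR (dotp s t) - (1 + dotp s t + dotp s t ^+ 2 / 2)) *
  expR (- ((dotp s s + dotp t t) / 2)).
Proof.
rewrite /kernelK !enorm_sqr mulrBl -expRD; congr (expR _ - _).
have -> : dotp (tsub s t) (tsub s t) = dotp s s - 2 * dotp s t + dotp t t.
  rewrite /dotp mulr_sumr -sumrB -big_split/=; apply: eq_bigr => i _.
  by rewrite tnth_mktuple; ring.
by lra.
Qed.

Lemma cvg_kernel_sum s t : kernel_sum N s t @[N --> \oo] --> kernelK s t.
Proof.
rewrite kernelKE; under eq_cvg do rewrite kernel_sumE.
apply: cvgM; last exact: cvg_cst.
have h : (\sum_(0 <= k < n) exp_coeff (dotp s t) k) -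
    (1 + dotp s t + dotp s t ^+ 2 / 2) @[n --> \oo] -->
    expR (dotp s t) - (1 + dotp s t + dotp s t ^+ 2 / 2).
  by apply: cvgB; [exact: cvg_sum_exp_coeff|exact: cvg_cst].
apply: cvg_trans h; apply: near_eq_cvg; exists 3%N => // n /= n3.
(* The terms of index 0, 1 and 2 are the subtracted polynomial. *)
rewrite (big_cat_nat (n := 3))//= [X in X + _ - _](_ : _ = 1 + dotp s t + dotp s t ^+ 2 / 2).
  by rewrite addrC addKr.
by rewrite /exp_coeff !big_nat_recl// big_geq//= expr0 expr1 !divr1 addr0 !addrA.
Qed.

End kernel_expansion.

(** * The quadratic form and the diagonal integral as series *)

Section integral_expansion.
Context {R : realType} {d : nat}.
Local Notation E := (d.-tuple (measurableTypeR R)).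
Variable P : probability E R.
Local Notation L2 := (LspaceType2 P).
Implicit Types (s t : E) (f g : L2).

Lemma measurable_feature n (w : {ffun 'I_n -> 'I_d}) :
  measurable_fun setT (feature (R := R) w).
Proof. by apply: measurable_funM => //; exact: measurable_wmon. Qed.

Lemma measurable_kernel_sum N s : measurable_fun setT (kernel_sum N s).
Proof.
apply: measurable_sum => n; apply: measurable_sum => w.
by apply: measurable_funM => //; exact: measurable_feature.
Qed.

Lemma wmon_Lfun w : wmon w \in Lfun P 2%:E.
Proof.
have [C wC] := @wmon_bounded R d w.
exact: Lfun2_bounded (measurable_wmon w) wC.
Qed.

Lemma feature_Lfun n (w : {ffun 'I_n -> 'I_d}) : feature w \in Lfun P 2%:E.
Proof.
have L := Lfun_submod_closed P (lee1n 2).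
by have := L.2 (Num.sqrt n`!%:R)^-1 _ _ (wmon_Lfun (codom w)) L.1; rewrite addr0.
Qed.

Definition L2feature n (w : {ffun 'I_n -> 'I_d}) : L2 := L2_of (feature_Lfun w).

Lemma L2_integrable f : P.-integrable setT (EFin \o f).
Proof.
by apply/Lfun1_integrable; apply: Lfun_subset12 (L2_Lfun f) => //; exact: fin_num_measure.
Qed.

Lemma integral_kernel_sum f N s : \int[P]_t (kernel_sum N s t * f t) =
  \sum_(3 <= n < N) \sum_(w : {ffun 'I_n -> 'I_d}) L2dot f (L2feature w) * feature w s.
Proof.
have iw n (w : {ffun 'I_n -> 'I_d}) :
    P.-integrable setT (EFin \o (fun t => feature w t * f t)).
  exact: Lfun2_mul_integrable (feature_Lfun w) (L2_Lfun f).
have isw n : P.-integrable setT (EFin \o (fun t =>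
    \sum_(w : {ffun 'I_n -> 'I_d}) feature w s * (feature w t * f t))).
  apply: integrable_sumr => w.
  exact: (integrableZl measurableT (feature w s) (iw n w)).
rewrite (@eq_Rintegral _ _ _ _ _ (fun t => \sum_(3 <= n < N)
    \sum_(w : {ffun 'I_n -> 'I_d}) feature w s * (feature w t * f t))); last first.
  move=> t _; rewrite mulr_suml; apply: eq_bigr => n _.
  by rewrite mulr_suml; apply: eq_bigr => w _; rewrite mulrA.
rewrite Rintegral_sum//; apply: eq_bigr => n _.
rewrite Rintegral_sum => [|w]; last first.
  exact: (integrableZl measurableT (feature w s) (iw n w)).
apply: eq_bigr => w _; rewrite RintegralZl// L2dotC /L2feature L2dot_of.
by rewrite mulrC.
Qed.

Lemma norm_integral_kernel_sum_le f N s :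
  `|\int[P]_t (kernel_sum N s t * f t)| <= \int[P]_t `|f t|.
Proof.
have fi := L2_integrable f.
have mk := measurable_kernel_sum N s.
have ki : P.-integrable setT (EFin \o (fun t => kernel_sum N s t * f t)).
  apply: le_integrable fi => //.
    by apply/measurable_EFinP; apply: measurable_funM => //; exact: L2_measurable.
  by move=> t _; rewrite /= lee_fin normrM ler_piMl// norm_kernel_sum_le.
apply: le_trans (le_normr_Rintegral measurableT ki) _.
apply: le_Rintegral => //; first exact: integrable_norm ki.
  exact: integrable_norm fi.
by move=> t _; rewrite normrM ler_piMl// norm_kernel_sum_le.
Qed.

Lemma cvg_integral_kernel_sum f s :
  \int[P]_t (kernel_sum N s t * f t) @[N --> \oo] --> \int[P]_t (kernelK s t * f t).
Proof.
have mk N := measurable_kernel_sum N s.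
apply: (cvg_dominated_Rintegral (G := fun t => `|f t|)).
- by move=> N; apply: measurable_funM => //; exact: L2_measurable.
- apply: measurable_funM; last exact: L2_measurable.
  by apply: (measurable_fun_cvg (h := fun N => kernel_sum N s)) => // t _; exact: cvg_kernel_sum.
- by apply: aeW => t; apply: cvgM; [exact: cvg_kernel_sum|exact: cvg_cst].
- exact: integrable_norm (L2_integrable f).
- by move=> N t; rewrite normrM ler_piMl// norm_kernel_sum_le.
Qed.

(** Dominated convergence twice: in [t] with bound [|f|], then in [s] with bound the L^1 norm of [f]
    times [|g|]. *)
Lemma cvg_sum_dot_feature f g :
  \sum_(3 <= n < N) \sum_(w : {ffun 'I_n -> 'I_d})
    L2dot f (L2feature w) * L2dot g (L2feature w) @[N --> \oo] -->
  \int[P]_s ((\int[P]_t (kernelK s t * f t)) * g s).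
Proof.
have mI N : measurable_fun setT (fun s => \int[P]_t (kernel_sum N s t * f t)).
  under eq_fun do rewrite integral_kernel_sum.
  apply: measurable_sum => n; apply: measurable_sum => w.
  by apply: measurable_funM => //; exact: measurable_feature.
have h : \int[P]_s ((\int[P]_t (kernel_sum N s t * f t)) * g s) @[N --> \oo] -->
    \int[P]_s ((\int[P]_t (kernelK s t * f t)) * g s).
  apply: (cvg_dominated_Rintegral (G := fun s => (\int[P]_t `|f t|) * `|g s|)).
  - by move=> N; apply: measurable_funM => //; exact: L2_measurable.
  - apply: measurable_funM; last exact: L2_measurable.
    apply: (measurable_fun_cvg (h := fun N s => \int[P]_t (kernel_sum N s t * f t))) => //.
    by move=> s _; exact: cvg_integral_kernel_sum.
  - by apply: aeW => s; apply: cvgM; [exact: cvg_integral_kernel_sum|exact: cvg_cst].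
  - exact: (integrableZl measurableT (\int[P]_t `|f t|) (integrable_norm (L2_integrable g))).
  - by move=> N s; rewrite normrM ler_wpM2r// norm_integral_kernel_sum_le.
apply: cvg_trans h; apply: near_eq_cvg; apply: nearW => N.
have iw n (w : {ffun 'I_n -> 'I_d}) :
    P.-integrable setT (EFin \o (fun t => L2dot f (L2feature w) * (feature w t * g t))).
  have := Lfun2_mul_integrable (feature_Lfun w) (L2_Lfun g).
  by move=> /(integrableZl measurableT (L2dot f (L2feature w))).
have isw n : P.-integrable setT (EFin \o (fun t =>
    \sum_(w : {ffun 'I_n -> 'I_d}) L2dot f (L2feature w) * (feature w t * g t))).
  exact: integrable_sumr.
rewrite (@eq_Rintegral _ _ _ _ _ (fun t => \sum_(3 <= n < N)
    \sum_(w : {ffun 'I_n -> 'I_d}) L2dot f (L2feature w) * (feature w t * g t))); last first.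
  move=> t _; rewrite integral_kernel_sum mulr_suml; apply: eq_bigr => n _.
  by rewrite mulr_suml; apply: eq_bigr => w _; rewrite mulrA.
rewrite Rintegral_sum//; apply: eq_bigr => n _.
rewrite Rintegral_sum//; apply: eq_bigr => w _.
rewrite RintegralZl//; last exact: Lfun2_mul_integrable (feature_Lfun w) (L2_Lfun g).
by rewrite (L2dotC g) /L2feature L2dot_of.
Qed.

Lemma cvg_sum_dot_feature_diag :
  \sum_(3 <= n < N) \sum_(w : {ffun 'I_n -> 'I_d})
    L2dot (L2feature w) (L2feature w) @[N --> \oo] --> \int[P]_s kernelK s s.
Proof.
have mk N : measurable_fun setT (fun s => kernel_sum N s s).
  apply: measurable_sum => n; apply: measurable_sum => w.
  by apply: measurable_funM => //; exact: measurable_feature.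
have h : \int[P]_s kernel_sum N s s @[N --> \oo] --> \int[P]_s kernelK s s.
  apply: (cvg_dominated_Rintegral (G := cst 1)) => //.
  - by apply: (measurable_fun_cvg (h := fun N s => kernel_sum N s s)) => // s _; exact: cvg_kernel_sum.
  - by apply: aeW => s; exact: cvg_kernel_sum.
  - exact: finite_measure_integrable_cst.
  - by move=> N s; exact: norm_kernel_sum_le.
apply: cvg_trans h; apply: near_eq_cvg; apply: nearW => N.
have iw n (w : {ffun 'I_n -> 'I_d}) :
    P.-integrable setT (EFin \o (fun t => feature w t * feature w t)).
  exact: Lfun2_mul_integrable (feature_Lfun w) (feature_Lfun w).
have isw n : P.-integrable setT (EFin \o (fun t =>
    \sum_(w : {ffun 'I_n -> 'I_d}) feature w t * feature w t)).
  exact: integrable_sumr.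
rewrite Rintegral_sum//; apply: eq_bigr => n _.
rewrite Rintegral_sum//; apply: eq_bigr => w _.
rewrite [RHS]L2dot_of; apply: ae_eq_Rintegral.
- by apply: measurable_funM; exact: measurable_feature.
- by apply: measurable_funM; [exact: measurable_feature|exact: L2_measurable].
- by apply: filterS (L2_ofP (feature_Lfun w)) => t ->.
Qed.

End integral_expansion.

(** * Gaussian integrals *)

Section normal_integrals.
Context {R : realType}.
Local Notation leb := (@lebesgue_measure R).

(** The Radon-Nikodym derivative equals [normal_pdf] almost everywhere, both having the same
    integral over every measurable set. *)
Lemma integral_normal_prob (m s : R) (f : R -> \bar R) :
  (normal_prob m s).-integrable setT f ->
  (\int[normal_prob m s]_x f x = \int[leb]_x (f x * (normal_pdf m s x)%:E))%E.
Proof.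
move=> fi; have dom := normal_prob_dominates m s.
have mpdf : measurable_fun setT (fun x => (normal_pdf m s x)%:E).
  by apply/measurable_EFinP; exact: measurable_normal_pdf.
pose nu := charge_of_finite_measure (normal_prob m s).
rewrite -(@Radon_Nikodym_change_of_variables _ _ R (normal_prob m s) leb dom _ _ measurableT fi).
have iRN := @Radon_Nikodym_integrable _ _ R nu leb dom.
have mf := measurable_int _ fi.
apply: ae_eq_integral => //.
- by apply: emeasurable_funM => //; exact: measurable_int iRN.
- exact: emeasurable_funM.
- apply: ae_eqe_mul2l; apply: integral_ae_eq => //.
  by move=> A _ mA; rewrite -(@Radon_Nikodym_integral _ _ R nu leb).
Qed.

Lemma integral_normal_expR (beta c : R) : 0 < beta -> 0 <= c ->
  (\int[normal_prob 0 beta]_x (expR (- (c * x ^+ 2)))%:E =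
   ((1 + 2 * c * beta ^+ 2) `^ (- 2^-1))%:E)%E.
Proof.
move=> beta0 c0; set k := 1 + _.
have k0 : 0 < k.
  by rewrite /k ltr_pwDl// mulr_ge0 ?sqr_ge0// mulr_ge0.
have mexp : measurable_fun setT (fun x : R => expR (- (c * x ^+ 2))).
  apply: measurableT_comp => //; apply: measurableT_comp => //.
  by apply: measurable_funM => //; exact: measurable_funX.
rewrite integral_normal_prob; last first.
  apply: (@le_integrable _ _ _ (normal_prob 0 beta) setT _ _ (cst 1%:E)) => //.
  - exact/measurable_EFinP.
  - move=> x _; rewrite /= normr1 lee_fin ger0_norm ?expR_ge0//.
    by rewrite -expR0 ler_expR oppr_le0 mulr_ge0 ?sqr_ge0.
  - exact: (@finite_measure_integrable_cst _ _ R (normal_prob 0 beta) setT 1).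
(* The exponential times the density of variance [beta^2] is [1 / sqrt k] times the density of
   variance [beta^2 / k]. *)
pose sigma := beta / Num.sqrt k.
have sk0 : 0 < Num.sqrt k by rewrite sqrtr_gt0.
have sigma0 : sigma != 0 by rewrite gt_eqF// divr_gt0.
have beta1 : beta != 0 by rewrite gt_eqF.
have sigma2 : sigma ^+ 2 = beta ^+ 2 / k.
  by rewrite /sigma expr_div_n sqr_sqrtr// ltW.
have A0 : Num.sqrt (beta ^+ 2 * pi *+ 2) != 0.
  by rewrite gt_eqF// sqrtr_gt0 mulrn_wgt0// mulr_gt0 ?pi_gt0// exprn_gt0.
have pdfE x : expR (- (c * x ^+ 2)) * normal_pdf 0 beta x =
    (Num.sqrt k)^-1 * normal_pdf 0 sigma x.
  rewrite !normal_pdfE//= /normal_fun !subr0 /normal_peak sigma2.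
  have -> : beta ^+ 2 / k * pi *+ 2 = (beta ^+ 2 * pi *+ 2) / k.
    by rewrite mulrAC mulrnAl.
  rewrite sqrtrM; last by rewrite mulrn_wge0// mulr_ge0 ?sqr_ge0 ?pi_ge0.
  rewrite sqrtrV ?ltW// invf_div.
  have -> : - x ^+ 2 / (beta ^+ 2 / k *+ 2) = - (c * x ^+ 2) + - x ^+ 2 / (beta ^+ 2 *+ 2).
    by rewrite /k; field; rewrite beta1 gt_eqF.
  rewrite expRD.
  by field; rewrite A0 gt_eqF.
under eq_integral do rewrite -EFinM pdfE EFinM.
rewrite ge0_integralZl//.
- by rewrite integral_normal_pdf mule1 powRN powR12_sqrt// ltW.
- by apply/measurable_EFinP; exact: measurable_normal_pdf.
- by move=> x _; rewrite lee_fin normal_pdf_ge0.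
Qed.

(** Induction on [d]: Tonelli splits off the first coordinate, which contributes a factor
    [k ^ (- 1 / 2)]. *)
Lemma integral_gaussian_expR (beta c : R) d : 0 < beta -> 0 <= c ->
  (\int[gaussian beta d]_t (expR (- (c * dotp t t)))%:E =
   ((1 + 2 * c * beta ^+ 2) `^ (- (d%:R / 2)))%:E)%E.
Proof.
move=> beta0 c0; set k := 1 + _.
have k0 : 0 < k by rewrite /k ltr_pwDl// mulr_ge0 ?sqr_ge0// mulr_ge0.
have mexp n : measurable_fun setT (fun t : n.-tuple (measurableTypeR R) =>
    (expR (- (c * dotp t t)))%:E).
  apply/measurable_EFinP; apply: measurableT_comp => //; apply: measurableT_comp => //.
  by apply: measurable_funM => //; exact: measurable_dotp.
elim: d => [|d IH].
  rewrite (eq_integral (cst 1%E)) => [|t _]; last first.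
    by rewrite /dotp big_ord0 mulr0 oppr0 expR0.
  rewrite integral_cst// [X in (_ * X)%E]probability_setT mule1.
  by rewrite mul0r oppr0 powRr0.
rewrite /= ge0_integral_distribution; last 2 first.
  exact: mexp.
  by move=> t; rewrite lee_fin expR_ge0.
rewrite fubini_tonelli1; last 2 first.
  by apply: measurableT_comp; [exact: mexp|exact: measurable_tuple_cons].
  by move=> t; rewrite lee_fin expR_ge0.
have dotE (x : measurableTypeR R) (t : d.-tuple (measurableTypeR R)) :
    dotp (tuple_cons (x, t)) (tuple_cons (x, t)) = x ^+ 2 + dotp t t :> R.
  rewrite /dotp big_ord_recl expr2; congr (_ + _).
  by apply: eq_bigr => i _; rewrite !tnthS.
rewrite (_ : fubini_F _ _ = fun x : measurableTypeR R => ((k `^ (- (d%:R / 2)))%:E * (expR (- (c * x ^+ 2)))%:E)%E).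
  rewrite ge0_integralZl//.
  - rewrite integral_normal_expR// -EFinM -powRD; last by rewrite (gt_eqF k0) implybT.
    by congr (_ `^ _)%:E; rewrite -natr1; field.
  - apply/measurable_EFinP; apply: measurableT_comp => //; apply: measurableT_comp => //.
    by apply: measurable_funM => //; exact: measurable_funX.
  - by rewrite lee_fin powR_ge0.
apply/funext => x; rewrite /fubini_F -IH muleC -ge0_integralZl//.
- apply: eq_integral => t _.
  rewrite -[LHS]/((expR (- (c * dotp (tuple_cons (x, t)) (tuple_cons (x, t)))))%:E).
  by rewrite dotE -EFinM -expRD mulrDr opprD.
- exact: mexp.
Qed.

End normal_integrals.

(** * Gaussian moments and the integral of the kernel on the diagonal *)

Section trace_value.
Context {R : realType}.

Lemma is_derive_expR_scale (q x : R) :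
  is_derive x 1 (fun c => expR (- (c * q))) (- q * expR (- (x * q))).
Proof.
have h : is_derive x 1 (fun c : R => - (c * q)) (- q).
  rewrite (_ : (fun c => _) = (- q) *: (@id R)).
    have := is_deriveZ (- q) (is_derive_id x (1 : R)).
    by rewrite /GRing.scale/= mulr1.
  by apply/funext => c; rewrite -[RHS]/(- q * c) mulNr mulrC.
have := @is_derive1_comp R expR (fun c => - (c * q)) x _ _ (is_derive_expR _) h.
by rewrite mulrC.
Qed.

Lemma is_derive_affine_powR (b a x : R) : 0 < 1 + 2 * x * b ->
  is_derive x 1 (fun c => (1 + 2 * c * b) `^ a)
    (a * (2 * b) * (1 + 2 * x * b) `^ (a - 1)).
Proof.
move=> k0.
have h : is_derive x 1 (fun c : R => 1 + 2 * c * b) (2 * b).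
  rewrite (_ : (fun c => _) = cst 1 + (2 * b) *: (@id R)).
    have := is_deriveD (is_derive_cst (1 : R) x 1) (is_deriveZ (2 * b) (is_derive_id x (1 : R))).
    by rewrite /GRing.scale/= mulr1 add0r.
  by apply/funext => c; rewrite -[RHS]/(1 + 2 * b * c) mulrAC.
have := @is_derive1_comp R (@powR R ^~ a) _ x _ _ (is_derive1_powR a k0) h.
by rewrite mulrAC.
Qed.

Lemma sqr_expRN_le (x : R) : 0 <= x -> x ^+ 2 * expR (- (2^-1 * x)) <= 8.
Proof.
move=> x0; rewrite expRN ler_pdivrMr ?expR_gt0//.
have y0 : 0 <= 2^-1 * x by rewrite mulr_ge0.
have : 1 + (2^-1 * x) ^+ 2 / 2 <= expR (2^-1 * x) := expR_ge1Dxn 1 y0.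
by move: (expR _) => e; have := sqr_ge0 x; nra.
Qed.

Lemma mul_expRN_le (x : R) : 0 <= x -> x * expR (- (2^-1 * x)) <= 2.
Proof.
move=> x0; rewrite expRN ler_pdivrMr ?expR_gt0//.
by have := expR_ge1Dx (2^-1 * x); lra.
Qed.

Variables (d : nat) (beta : R).
Hypothesis beta_gt0 : 0 < beta.
Local Notation P := (gaussian beta d).
Local Notation E := (d.-tuple (measurableTypeR R)).
Local Notation k c := (1 + 2 * c * beta ^+ 2).
Implicit Types c x : R.

Let m_dotp : measurable_fun setT (fun t : E => dotp t t) := measurable_dotp.

Let m_exp c : measurable_fun setT (fun t : E => expR (- (c * dotp t t))).
Proof.
apply: measurableT_comp => //; apply: measurableT_comp => //.
exact: measurable_funM.
Qed.

Let Rintegral_expR c : 0 <= c ->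
  \int[P]_t expR (- (c * dotp t t)) = k c `^ (- (d%:R / 2)).
Proof. by move=> c0; rewrite /Rintegral integral_gaussian_expR. Qed.

Let k_gt0 c : 0 <= c -> 0 < k c.
Proof. by move=> c0; rewrite ltr_pwDl// mulr_ge0 ?sqr_ge0// mulr_ge0. Qed.

Let expR_le1 c (t : E) : 0 <= c -> expR (- (c * dotp t t)) <= 1.
Proof. by move=> c0; rewrite -expR0 ler_expR oppr_le0 mulr_ge0// dotp_ge0. Qed.

Let expR_le_half c (t : E) : 2^-1 < c ->
  expR (- (c * dotp t t)) <= expR (- (2^-1 * dotp t t)).
Proof. by move=> c2; rewrite ler_expR lerN2 ler_wpM2r ?dotp_ge0// ltW. Qed.

Let near_half_gt0 (x : R) : 2^-1 < x -> \forall c \near x, 2^-1 < c.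
Proof. by move=> x2; exact: lt_nbhsr. Qed.

(** Differentiates [Rintegral_expR] under the integral sign. Keeping the parameter above 1/2 makes
    the constant 2 of [mul_expRN_le] dominate the derivative. *)
Lemma gaussian_moment1 c : 2^-1 < c ->
  \int[P]_t (- dotp t t * expR (- (c * dotp t t))) =
  - (d%:R * beta ^+ 2) * k c `^ (- (d%:R / 2) - 1).
Proof.
move=> c2; have c0 : 0 < c by lra.
have Ic : `]2^-1, c + 1[%classic c by rewrite /= in_itv/=; apply/andP; split; lra.
have der (x : R) (t : E) : is_derive x 1 (fun c : R => expR (- (c * dotp t t)))
    (- dotp t t * expR (- (x * dotp t t))) := is_derive_expR_scale _ _.
have := @differentiation_under_integral R _ E P
  (fun c t => expR (- (c * dotp t t))) setT measurableT c (2^-1) (c + 1) Ic.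
rewrite /partial1of2.
have dE (x : R) (t : E) : (fun c : R => expR (- (c * dotp t t)))^`()%classic x =
    - dotp t t * expR (- (x * dotp t t)).
  by rewrite derive1E; exact: (@derive_val _ _ _ _ _ _ _ (der x t)).
under eq_Rintegral do rewrite dE.
move=> /(_ _ _ (cst 2)) <-.
- rewrite derive1E.
  have h : is_derive c 1 (fun c => k c `^ (- (d%:R / 2)))
      (- (d%:R / 2) * (2 * beta ^+ 2) * k c `^ (- (d%:R / 2) - 1)).
    by apply: is_derive_affine_powR; rewrite k_gt0// ltW.
  rewrite (near_eq_derive 1 (g := fun c => k c `^ (- (d%:R / 2)))).
    by rewrite (@derive_val _ _ _ _ _ _ _ h); congr (_ * _); field.
  apply: filterS (near_half_gt0 c2) => x x2; apply: Rintegral_expR.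
  by rewrite (le_trans _ (ltW x2)).
- move=> x /=; rewrite in_itv/= => /andP[x2 _].
  apply: (@bounded_integrable _ _ _ P _ 1) => // t; rewrite ger0_norm ?expR_ge0//.
  by apply: expR_le1; rewrite (le_trans _ (ltW x2)).
- by move=> x t _ _; apply: ex_derive; exact: der.
- exact: (fun=> ler0n R 2).
- exact: (@finite_measure_integrable_cst _ _ R P setT 2).
- move=> x t /=; rewrite in_itv/= => /andP[x2 _] _.
  rewrite dE normrM normrN (ger0_norm (dotp_ge0 t)) (ger0_norm (expR_ge0 _)).
  apply: le_trans (mul_expRN_le (dotp_ge0 t)).
  by rewrite ler_wpM2l ?dotp_ge0//; exact: expR_le_half.
Qed.

(** A second differentiation, starting from [gaussian_moment1], with the constant 8 of
    [sqr_expRN_le] as dominating function. *)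
Lemma gaussian_moment2 c : 2^-1 < c ->
  \int[P]_t (dotp t t ^+ 2 * expR (- (c * dotp t t))) =
  d%:R * (d%:R + 2) * beta ^+ 4 * k c `^ (- (d%:R / 2) - 2).
Proof.
move=> c2; have c0 : 0 < c by lra.
have Ic : `]2^-1, c + 1[%classic c by rewrite /= in_itv/=; apply/andP; split; lra.
have der (x : R) (t : E) : is_derive x 1 (fun c : R => - dotp t t * expR (- (c * dotp t t)))
    (dotp t t ^+ 2 * expR (- (x * dotp t t))).
  have h := is_derive_expR_scale (dotp t t) x.
  have := is_deriveZ (- dotp t t) h.
  by rewrite /GRing.scale/= mulrA mulrNN -expr2.
have := @differentiation_under_integral R _ E P
  (fun c t => - dotp t t * expR (- (c * dotp t t))) setT measurableT c (2^-1) (c + 1) Ic.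
rewrite /partial1of2.
have dE (x : R) (t : E) : (fun c : R => - dotp t t * expR (- (c * dotp t t)))^`()%classic x =
    dotp t t ^+ 2 * expR (- (x * dotp t t)).
  by rewrite derive1E; exact: (@derive_val _ _ _ _ _ _ _ (der x t)).
under eq_Rintegral do rewrite dE.
move=> /(_ _ _ (cst 8)) <-.
- rewrite derive1E.
  have h := is_derive_affine_powR (- (d%:R / 2) - 1) (k_gt0 (ltW c0)).
  have {}h := is_deriveZ (- (d%:R * beta ^+ 2)) h.
  rewrite (near_eq_derive 1
    (g := (- (d%:R * beta ^+ 2)) *: (fun c => k c `^ (- (d%:R / 2) - 1)))).
    rewrite (@derive_val _ _ _ _ _ _ _ h) /GRing.scale/= !mulrA.
    have -> : - (d%:R / 2) - 1 - 1 = - (d%:R / 2) - 2 :> R by ring.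
    by congr (_ * _); field.
  by apply: filterS (near_half_gt0 c2) => x x2; exact: gaussian_moment1.
- move=> x /=; rewrite in_itv/= => /andP[x2 _].
  apply: (@bounded_integrable _ _ _ P _ 2) => [|t].
    by apply: measurable_funM => //; exact: measurableT_comp.
  rewrite normrM normrN (ger0_norm (dotp_ge0 t)) (ger0_norm (expR_ge0 _)).
  apply: le_trans (mul_expRN_le (dotp_ge0 t)).
  by rewrite ler_wpM2l ?dotp_ge0//; exact: expR_le_half.
- by move=> x t _ _; apply: ex_derive; exact: der.
- exact: (fun=> ler0n R 8).
- exact: (@finite_measure_integrable_cst _ _ R P setT 8).
- move=> x t /=; rewrite in_itv/= => /andP[x2 _] _.
  rewrite dE normrM (ger0_norm (sqr_ge0 _)) (ger0_norm (expR_ge0 _)).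
  apply: le_trans (sqr_expRN_le (dotp_ge0 t)).
  by rewrite ler_wpM2l ?sqr_ge0//; exact: expR_le_half.
Qed.

(** With [q = |t|^2], the diagonal is [1 - (1 + q + q^2 / 2) exp (- q)]; its terms are the moments
    at [c = 1]. *)
Lemma Rintegral_kernelK_diag : \int[P]_t kernelK t t =
  1 - (1 + 2 * beta ^+ 2) `^ (- (d%:R / 2))
    - d%:R * beta ^+ 2 * (1 + 2 * beta ^+ 2) `^ (- (d%:R / 2) - 1)
    - d%:R * (d%:R + 2) / 2 * beta ^+ 4
      * (1 + 2 * beta ^+ 2) `^ (- (d%:R / 2) - 2).
Proof.
have h1 : 2^-1 < 1 :> R by lra.
have m0 := Rintegral_expR ler01.
have m1 := gaussian_moment1 h1; have m2 := gaussian_moment2 h1.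
rewrite mulr1 in m0 m1 m2.
have i1 : P.-integrable setT (EFin \o cst (1 : R)).
  exact: finite_measure_integrable_cst.
have i2 : P.-integrable setT (EFin \o (fun t => expR (- (1 * dotp t t)))).
  apply: (@bounded_integrable _ _ _ P _ 1) => // t; rewrite ger0_norm ?expR_ge0//.
  exact: expR_le1.
have i3 : P.-integrable setT (EFin \o (fun t => - dotp t t * expR (- (1 * dotp t t)))).
  apply: (@bounded_integrable _ _ _ P _ 2) => [|t].
    by apply: measurable_funM => //; exact: measurableT_comp.
  rewrite normrM normrN (ger0_norm (dotp_ge0 t)) (ger0_norm (expR_ge0 _)).
  apply: le_trans (mul_expRN_le (dotp_ge0 t)).
  by rewrite ler_wpM2l ?dotp_ge0//; exact: expR_le_half.
have i4 : P.-integrable setT (EFin \o (fun t => dotp t t ^+ 2 * expR (- (1 * dotp t t)))).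
  apply: (@bounded_integrable _ _ _ P _ 8) => [|t].
    by apply: measurable_funM => //; exact: measurable_funX.
  rewrite normrM (ger0_norm (sqr_ge0 _)) (ger0_norm (expR_ge0 _)).
  apply: le_trans (sqr_expRN_le (dotp_ge0 t)).
  by rewrite ler_wpM2l ?sqr_ge0//; exact: expR_le_half.
have i4' : P.-integrable setT (EFin \o (fun t => 2^-1 *
    (dotp t t ^+ 2 * expR (- (1 * dotp t t))))).
  exact: (integrableZl measurableT 2^-1 i4).
have i12 : P.-integrable setT (EFin \o (fun t => cst 1 t - expR (- (1 * dotp t t)))).
  exact: (integrableB measurableT i1 i2).
have i123 : P.-integrable setT (EFin \o (fun t => (cst 1 t - expR (- (1 * dotp t t))) +
    - dotp t t * expR (- (1 * dotp t t)))).
  exact: (integrableD measurableT i12 i3).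
rewrite (@eq_Rintegral _ _ _ _ _ (fun t => (cst 1 t - expR (- (1 * dotp t t))) +
    (- dotp t t * expR (- (1 * dotp t t))) -
    2^-1 * (dotp t t ^+ 2 * expR (- (1 * dotp t t))))).
  rewrite RintegralB// RintegralD// RintegralB// RintegralZl// m0 m1 m2.
  rewrite Rintegral_cst// [X in fine X]probability_setT/= mulr1.
  by rewrite !mulrA; field.
move=> t _; rewrite kernelKE mul1r mulrBl -expRD.
have -> : dotp t t + - ((dotp t t + dotp t t) / 2) = 0 by lra.
have -> : (dotp t t + dotp t t) / 2 = dotp t t by lra.
by rewrite expR0 /cst; ring.
Qed.

End trace_value.

(** Tonelli for nonnegative double series, proved with extended real sums and brought back to real
    limits. *)
Lemma cvg_series_interchange {R : realType} (a : nat -> nat -> R) (r c : nat -> R) (T : R) :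
  (forall k n, 0 <= a k n) ->
  (forall k, \sum_(0 <= n < N) a k n @[N --> \oo] --> r k) ->
  (forall n, \sum_(0 <= k < N) a k n @[N --> \oo] --> c n) ->
  \sum_(0 <= n < N) c n @[N --> \oo] --> T ->
  \sum_(0 <= k < N) r k @[N --> \oo] --> T.
Proof.
move=> a0 ar ac cT.
have eseriesE (u : nat -> R) l : \sum_(0 <= n < N) u n @[N --> \oo] --> l ->
    (\sum_(0 <= n <oo) (u n)%:E = l%:E)%E.
  move=> ul; apply: cvg_lim => //.
  under eq_cvg do rewrite sumEFin.
  by apply: cvg_EFin; [exact: nearW|exact: ul].
have r0 k : 0 <= r k.
  rewrite -(cvg_lim (@Rhausdorff R) (ar k)); apply: limr_ge.
    by apply/cvg_ex; exists (r k); exact: ar.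
  by apply: nearW => N; exact: sumr_ge0.
have rT : (\sum_(0 <= k <oo) (r k)%:E = T%:E)%E.
  rewrite -(eseriesE _ _ cT).
  under eq_eseriesr do rewrite -(eseriesE _ _ (ar _)).
  rewrite nneseries_interchange; last by move=> i j; rewrite lee_fin.
  by apply: eq_eseriesr => n _; rewrite (eseriesE _ _ (ac n)).
have : (\sum_(0 <= k < N) (r k)%:E)%E @[N --> \oo] --> T%:E.
  by rewrite -rT; apply: is_cvg_nneseries => k _ _; rewrite lee_fin.
move/fine_cvgP => [_]; apply: cvg_trans; apply: near_eq_cvg; apply: nearW => N /=.
by rewrite sumEFin.
Qed.

(** * Marginals of the Gaussian measure and infinite dimension *)

Section gaussian_coordinates.
Context {R : realType}.
Variables (beta : R) (d : nat) (i : 'I_d).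
Hypothesis beta_gt0 : 0 < beta.
Local Notation E := (d.-tuple (measurableTypeR R)).
Local Notation P := (gaussian beta d).

Lemma gaussian_coord (A : set (measurableTypeR R)) : measurable A ->
  P [set t | A (tnth t i)] = normal_prob 0 beta A.
Proof.
move=> mA.
have -> : [set t : E | A (tnth t i)] =
    [set t | forall j, (if j == i then A else setT) (tnth t j)].
  apply/seteqP; split => t /= At; last by have := At i; rewrite eqxx.
  by move=> j; case: eqVneq => [->|].
rewrite (@gaussian_box R beta d (fun j => if j == i then A else setT)); last by move=> j; case: ifP.
rewrite (bigD1 i)//= eqxx big1 ?mule1// => j ji.
by rewrite (negbTE ji) [LHS]probability_setT.
Qed.

Lemma gaussian_coord_eq0 : P [set t | tnth t i = 0] = 0%E.
Proof.
rewrite (@gaussian_coord [set 0])//.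
have := normal_prob_dominates (0 : R) beta => /null_content_dominatesP; apply => //.
exact: lebesgue_measure_set1.
Qed.

Lemma normal_prob_itv_gt0 n :
  (0 < normal_prob 0 beta (`[n%:R, n.+1%:R[%classic : set (measurableTypeR R)))%E.
Proof.
have b0 : beta != 0 by rewrite gt_eqF.
(* The density decreases on the positive half-line, so its value at the right endpoint bounds it
   below on the interval. *)
pose m := normal_pdf 0 beta n.+1%:R.
have m0 : 0 < m.
  by rewrite /m normal_pdfE//= mulr_gt0 ?expR_gt0// normal_peak_gt0.
have leb1 : lebesgue_measure (`[n%:R, n.+1%:R[%classic : set R) = 1%E.
  rewrite lebesgue_measure_itv/= lte_fin ltr_nat ltnSn -EFinB -natrB ?leqnSn//.
  by rewrite subSnn.
apply: (@lt_le_trans _ _ (\int[lebesgue_measure]_(x in `[n%:R, n.+1%:R[) (cst m%:E x))%E).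
  by rewrite integral_cst// [X in (_ * X)%E]leb1 mule1 lte_fin.
apply: ge0_le_integral => //.
- by move=> x _; rewrite lee_fin ltW.
- by apply/measurable_EFinP; apply: measurable_funTS; exact: measurable_normal_pdf.
- move=> x; rewrite /= in_itv/= => /andP[nx xn]; rewrite lee_fin /m !normal_pdfE//=.
  rewrite ler_wpM2l ?normal_peak_ge0// /normal_fun ler_expR !subr0 !mulNr lerN2.
  rewrite ler_wpM2r ?invr_ge0 ?mulrn_wge0 ?sqr_ge0// lerXn2r ?nnegrE//.
  + by rewrite (le_trans _ nx).
  + exact: ltW.
Qed.

Let slab n : set E := [set t | `[n%:R, n.+1%:R[%classic (tnth t i : R)].

Let measurable_slab n : measurable (slab n).
Proof.
rewrite -[X in measurable X]setTI.
exact: (@measurable_coord R d i measurableT _ (measurable_itv _)).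
Qed.

Let slab_Lfun n (a : R) : (fun t => a * \1_(slab n) t) \in Lfun P 2%:E.
Proof.
apply: (@Lfun2_bounded _ _ _ _ _ (`|a|)).
  by apply: measurable_funM => //; exact: measurable_indic.
move=> t; rewrite normrM indicE; case: (_ \in _); rewrite ?normr1 ?normr0 ?mulr1 ?mulr0//.
Qed.

Let p n : R := fine (P (slab n)).

Let p_gt0 n : 0 < p n.
Proof.
rewrite /p fine_gt0// (@gaussian_coord `[n%:R, n.+1%:R[%classic)//.
by rewrite normal_prob_itv_gt0/= -ge0_fin_numE// fin_num_measure.
Qed.

(** Normalized indicators of the disjoint slabs, each of which has positive measure. *)
Lemma gaussian_orthonormal_sequence :
  exists u : nat -> LspaceType2 P, forall n, orthonormal_upto u n.
Proof.
exists (fun n => L2_of (slab_Lfun n (Num.sqrt (p n))^-1)) => N m n _ _.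
rewrite L2dot_of; have [->|mn] := eqVneq m n.
  rewrite (@ae_eq_Rintegral _ _ _ _ _ (fun t => (p n)^-1 * \1_(slab n) t)).
  - rewrite RintegralZl//; last first.
      apply: (@bounded_integrable _ _ _ P _ 1); first exact: measurable_indic.
      by move=> t; rewrite indicE; case: (_ \in _); rewrite ?normr1 ?normr0.
    by rewrite /Rintegral integral_indic// setIT mulVf ?gt_eqF.
  - apply: measurable_funM; last exact: L2_measurable.
    by apply: measurable_funM => //; exact: measurable_indic.
  - by apply: measurable_funM => //; exact: measurable_indic.
  - apply: filterS (L2_ofP (slab_Lfun n (Num.sqrt (p n))^-1)) => t ->.
    rewrite mulrACA -expr2 exprVn sqr_sqrtr ?ltW//; congr (_ * _).
    by rewrite indicE; case: (_ \in _); rewrite ?mulr1 ?mulr0.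
rewrite (@ae_eq_Rintegral _ _ _ _ _ (cst 0)).
- by rewrite Rintegral_cst// mul0r.
- apply: measurable_funM; last exact: L2_measurable.
  by apply: measurable_funM => //; exact: measurable_indic.
- exact: measurable_cst.
- apply: filterS (L2_ofP (slab_Lfun n (Num.sqrt (p n))^-1)) => t ->.
  rewrite mulrACA [X in _ * X](_ : _ = 0) ?mulr0// !indicE.
  have [/set_mem|] := boolP (t \in slab m); last by rewrite mul0r.
  rewrite /slab/= in_itv/= => /andP[mt tm].
  have [/set_mem|] := boolP (t \in _); last by rewrite mulr0.
  rewrite /= in_itv/= => /andP[nt tn].
  have := le_lt_trans mt tn; have := le_lt_trans nt tm; rewrite !ltr_nat !ltnS => nm mn'.
  by move: mn; rewrite eqn_leq nm mn'.
Qed.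

End gaussian_coordinates.

(** * The operator *)

Section operatorA_theory.
Context {R : realType}.
Variables (d : nat) (beta : R).
Hypotheses (d_gt0 : (0 < d)%N) (beta_gt0 : 0 < beta).
Local Notation P := (gaussian beta d).
Local Notation L2 := (LspaceType2 P).
Local Notation dot := (@L2dot _ _ _ P).
Local Notation norm := (@L2norm _ _ _ P).
Local Notation A := (@operatorA R beta d).
Implicit Types f g h : L2.

Let i0 : 'I_d := Ordinal d_gt0.

Let features N f g : R := \sum_(3 <= n < N) \sum_(w : {ffun 'I_n -> 'I_d})
  dot f (L2feature P w) * dot g (L2feature P w).

Lemma cvg_features f g : features N f g @[N --> \oo] --> dot (A f) g.
Proof.
rewrite [X in _ --> X]L2dot_of; exact: cvg_sum_dot_feature.
Qed.

Let features_ge0 N f : 0 <= features N f f.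
Proof. by apply: sumr_ge0 => n _; apply: sumr_ge0 => w _; rewrite -expr2 sqr_ge0. Qed.

Let features_nd f : nondecreasing_seq (fun N => features N f f).
Proof.
apply/nondecreasing_seqP => N; rewrite /features.
have [N3|N3] := leqP 3 N; last by rewrite !big_geq// ltnW.
rewrite big_nat_recr//= lerDl; apply: sumr_ge0 => w _; rewrite -expr2; exact: sqr_ge0.
Qed.

Let features_le f N : features N f f <= dot (A f) f.
Proof.
rewrite -(cvg_lim (@Rhausdorff R) (@cvg_features f f)).
apply: (nondecreasing_cvgn_le (u_ := fun N => features N f f)) => //.
by apply/cvg_ex; exists (dot (A f) f); exact: cvg_features.
Qed.

Lemma operatorA_adjoint : adjoint_of A A.
Proof.
move=> f g; apply: (cvg_unique (@Rhausdorff R) (@cvg_features f g)).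
rewrite (L2dotC f); apply: cvg_trans (@cvg_features g f).
apply: near_eq_cvg; apply: nearW => N; apply: eq_bigr => n _.
by apply: eq_bigr => w _; rewrite mulrC.
Qed.

Lemma operatorA_ge0 f : 0 <= dot (A f) f.
Proof. exact: le_trans (features_ge0 0 f) (features_le f 0). Qed.

(** Tested against every [h], where the expansion is linear term by term. *)
Lemma operatorA_linear : linear A.
Proof.
move=> a f g; apply: L2dot_inj => h.
rewrite L2dotDl L2dotZl; apply: (cvg_unique (@Rhausdorff R) (@cvg_features _ _)).
have c : a * features N f h + features N g h @[N --> \oo] --> a * dot (A f) h + dot (A g) h.
  apply: cvgD; last exact: cvg_features.
  by apply: cvgM; [exact: cvg_cst|exact: cvg_features].
apply: cvg_trans c; apply: near_eq_cvg; apply: nearW => N.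
rewrite /features mulr_sumr -big_split; apply: eq_bigr => n _.
rewrite mulr_sumr -big_split; apply: eq_bigr => w _.
by rewrite L2dotDl L2dotZl mulrDl mulrA.
Qed.

Let T : R := \int[P]_s kernelK s s.

Lemma sum_features_le N : \sum_(3 <= n < N) \sum_(w : {ffun 'I_n -> 'I_d})
  dot (L2feature P w) (L2feature P w) <= T.
Proof.
have c := @cvg_sum_dot_feature_diag R d P.
rewrite /T -(cvg_lim (@Rhausdorff R) c).
apply: (nondecreasing_cvgn_le (u_ := fun N => \sum_(3 <= n < N)
  \sum_(w : {ffun 'I_n -> 'I_d}) dot (L2feature P w) (L2feature P w))).
  apply/nondecreasing_seqP => m.
  have [m3|m3] := leqP 3 m; last by rewrite !big_geq// ltnW.
  by rewrite big_nat_recr//= lerDl; apply: sumr_ge0 => w _; exact: L2dot_ge0.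
by apply/cvg_ex; exists T; exact: c.
Qed.

(** Cauchy-Schwarz on each term leaves the sum of the squared norms of the phi_w, which is at most
    [T]. *)
Lemma norm_dot_operatorA_le f g : `|dot (A f) g| <= T * norm f * norm g.
Proof.
have T0 : 0 <= T by have := sum_features_le 0; rewrite big_geq.
have c : `|features N f g| @[N --> \oo] --> `|dot (A f) g|.
  by apply: cvg_norm; exact: cvg_features.
rewrite -(cvg_lim (@Rhausdorff R) c); apply: limr_le.
  by apply/cvg_ex; exists `|dot (A f) g|; exact: c.
apply: nearW => N; apply: (@le_trans _ _ (\sum_(3 <= n < N)
    \sum_(w : {ffun 'I_n -> 'I_d})
    dot (L2feature P w) (L2feature P w) * (norm f * norm g))).
  apply: le_trans (ler_norm_sum _ _ _) _; apply: ler_sum => n _.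
  apply: le_trans (ler_norm_sum _ _ _) _; apply: ler_sum => w _.
  rewrite normrM -sqr_L2norm expr2 mulrACA.
  by rewrite (mulrC (norm (L2feature P w)) (norm f)) ler_pM//;
    rewrite ?(mulrC _ (norm g)) L2_CauchySchwarz.
under eq_bigr do rewrite -mulr_suml.
rewrite -mulr_suml -mulrA ler_wpM2r ?sum_features_le//.
by rewrite mulr_ge0 ?L2norm_ge0.
Qed.

Lemma operatorA_bounded : bounded_linear A.
Proof.
split; first exact: operatorA_linear.
exists T => f; have [A0|A0] := eqVneq (norm (A f)) 0.
  rewrite A0 mulr_ge0 ?L2norm_ge0//.
  by have := sum_features_le 0; rewrite big_geq.
have Apos : 0 < norm (A f) by rewrite lt_neqAle eq_sym A0 L2norm_ge0.
(* The bilinear bound with [g = A f], divided by the norm of [A f]. *)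
rewrite -(ler_pM2r Apos) -expr2 sqr_L2norm.
by apply: le_trans (norm_dot_operatorA_le f (A f)); rewrite ler_norm.
Qed.

Lemma operatorA_self_adjoint : self_adjoint A.
Proof. by split; [exact: operatorA_bounded|exact: operatorA_adjoint]. Qed.

Lemma operatorA_nonnegative : nonnegative_operator A.
Proof. by split; [exact: operatorA_self_adjoint|exact: operatorA_ge0]. Qed.

(** If [A h = 0], the sum of squares [<A h, h>] vanishes, so [h] is orthogonal to all phi_w with
    [|w| >= 3]. Their totality makes [h] orthogonal to itself. *)
Lemma operatorA_injective : injective A.
Proof.
move=> f g fg; apply/eqP; rewrite -subr_eq0; set h := f - g.
have Ah0 : dot (A h) h = 0.
  have -> : A h = -1 *: A g + A f by rewrite -operatorA_linear scaleN1r addrC.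
  by rewrite fg scaleN1r addNr L2dot0l.
(* Truncating at [n.+1] is what includes the words of length [n]. *)
have h0 n (w : {ffun 'I_n -> 'I_d}) : (2 < n)%N -> dot h (L2feature P w) = 0.
  move=> n3; have := features_le h n.+1; rewrite Ah0 /features big_nat_recr//= => s0.
  have ge0 (m : nat) (v : {ffun 'I_m -> 'I_d}) :
      0 <= dot h (L2feature P v) * dot h (L2feature P v) by rewrite -expr2 sqr_ge0.
  have hle : dot h (L2feature P w) * dot h (L2feature P w) <= 0.
    apply: le_trans s0; rewrite (bigD1 w)//= addrCA lerDl.
    by rewrite addr_ge0 ?sumr_ge0// => m _; rewrite sumr_ge0.
  by apply/eqP; rewrite -sqrf_eq0 expr2 eq_le hle ge0.
apply/eqP/L2dot_eq0.
suff orth_h : forall u, [set g | dot h g = 0] u by exact: orth_h h.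
apply: (closed_subspace_wmon_full (closed_subspace_orth h) _ (gaussian_coord_eq0 beta i0)).
move=> w w2; pose v := [ffun j => tnth (in_tuple w) j].
have vw : codom v = w.
  rewrite /codom /image_mem -[RHS](map_tnth_enum (in_tuple w)).
  by apply: eq_map => j; rewrite ffunE.
have -> : wmon w = (fun t => Num.sqrt (size w)`!%:R * feature v t) :> (_ -> R).
  by apply/funext => t; rewrite /feature vw mulrA mulfV ?mul1r// sqrtr_eq0 -ltNge ltr0n fact_gt0.
apply: (in_subspaceZ (closed_subspace_orth h)).
by exists (feature_Lfun P v); exact: h0.
Qed.

Lemma gaussian_orthonormal_basis : exists e : nat -> L2, orthonormal_basis e.
Proof.
have [u un] := gaussian_orthonormal_sequence i0 beta_gt0.
(* Words are countable: [x] enumerates them by their codes, with 0 at numbers that encode no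
   word. *)
pose x m : L2 := if unpickle m is Some w then L2_of (wmon_Lfun P w) else 0.
apply: (orthonormal_basis_exists (x := x) _ un) => S cS xS.
apply: (closed_subspace_wmon_full cS _ (gaussian_coord_eq0 beta i0)) => w _.
exists (wmon_Lfun P w); apply: xS; exists (pickle w) => //.
by rewrite /x pickleK.
Qed.

(** Sum the squared coefficients of the phi_w in two orders: over words first they give
    [<A e_k, e_k>], over [k] first they give squared norms by Parseval. *)
Lemma operatorA_has_trace : has_trace A T.
Proof.
(* Lengths below 3 are padded with zeros so that the double series starts at index 0. *)
move=> e eb; pose a k n : R := if (2 < n)%N then \sum_(w : {ffun 'I_n -> 'I_d})
  dot (L2feature P w) (e k) ^+ 2 else 0.
pose c n : R := if (2 < n)%N then \sum_(w : {ffun 'I_n -> 'I_d})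
  dot (L2feature P w) (L2feature P w) else 0.
have sum3 (b : nat -> R) N :
    \sum_(0 <= n < N) (if (2 < n)%N then b n else 0) = \sum_(3 <= n < N) b n.
  by rewrite [RHS](big_nat_widenl _ 0)//= [RHS]big_mkcond.
apply: (@cvg_series_interchange _ a _ c).
- by move=> k n; rewrite /a; case: ifP => // _; apply: sumr_ge0 => w _; exact: sqr_ge0.
- move=> k; apply: cvg_trans (@cvg_features (e k) (e k)).
  apply: near_eq_cvg; apply: nearW => N; rewrite sum3; apply: eq_bigr => n _.
  by apply: eq_bigr => w _; rewrite expr2 (L2dotC (e k)).
- move=> n; rewrite /a /c; case: ifP => _; last first.
    by under eq_cvg do rewrite big1//; exact: cvg_cst.
  under eq_cvg do rewrite exchange_big/=.
  apply: cvg_big => [|w _]; first exact: add_continuous.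
  apply: cvg_trans (@Parseval _ _ _ _ e (L2feature P w) eb).
  by apply: near_eq_cvg; apply: nearW => N; rewrite big_mkord.
- apply: cvg_trans (@cvg_sum_dot_feature_diag R d P).
  by apply: near_eq_cvg; apply: nearW => N; rewrite sum3.
Qed.

(** [A] is its own adjoint and its own absolute value, so the series to be summed is the trace
    series of [A]. *)
Lemma operatorA_trace_class : trace_class A.
Proof.
split; first exact: operatorA_bounded.
exists A.
  split; first exact: operatorA_nonnegative.
  by exists A; split=> //; [exact: operatorA_bounded|exact: operatorA_adjoint].
have [e eb] := gaussian_orthonormal_basis; exists e => //.
by apply/cvg_ex; exists T; exact: operatorA_has_trace.
Qed.

End operatorA_theory.

Theorem proposition4p4 (R : realType) (d : nat) (beta : R)
    (d_gt0 : (0 < d)%N) (beta_gt0 : 0 < beta) :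
  [/\ nonnegative_operator (@operatorA R beta d),
      self_adjoint (@operatorA R beta d),
      trace_class (@operatorA R beta d),
      has_trace (@operatorA R beta d)
        (1 - (1 + 2 * beta ^+ 2) `^ (- (d%:R / 2))
           - d%:R * beta ^+ 2 * (1 + 2 * beta ^+ 2) `^ (- (d%:R / 2) - 1)
           - d%:R * (d%:R + 2) / 2 * beta ^+ 4
             * (1 + 2 * beta ^+ 2) `^ (- (d%:R / 2) - 2))
    & injective (@operatorA R beta d)].
Proof.
split.
- exact: operatorA_nonnegative.
- exact: operatorA_self_adjoint.
- exact: operatorA_trace_class.
- by rewrite -Rintegral_kernelK_diag//; exact: operatorA_has_trace.
- exact: operatorA_injective.
Qed.
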